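(* Let $\mathcal V$ be a Banach space equipped with an admissible family of matrix norms, $\Omega\subset\mathcal V_{\rm nc}$ a nc set which is open in the disjoint union topology, $\mathcal A$ a unital $C^*$-algebra, $\mathcal Y$ a Hilbert space. (1) Let $K$ be a cp nc kernel on $\Omega$ with values in $\mathcal L(\mathcal A,\mathcal L(\mathcal Y))_{\rm nc}$ that is $P$-locally bounded. Let $(\mathcal H(K),\sigma)$ be the corresponding nc reproducing kernel Hilbert space and let $H$ be the factor in the corresponding minimal Kolmogorov decomposition. Then each $f\in\mathcal H(K)$ as well as $H$ are both locally bounded and locally completely bounded. More precisely, let $n\in\mathbb N$, $Z\in\Omega_n$, and assume that $K(Z+D_Z,Z+D_Z)(1_{\mathcal A^{n\times n}})$ is defined and bounded for all $D_Z\in\mathcal V^{n\times n}$ with $\|D_Z\|<\epsilon$; then for each $f\in\mathcal H(K)$, $\|f(Z+D_Z)\|$ and $\|f(Z+D_Z)\|_{\rm cb}$ as well as $\|H(Z+D_Z)\|$ and $\|H(Z+D_Z)\|_{\rm cb}$ are bounded for $\|D_Z\|<\epsilon$. (2) Conversely, let $\mathcal H$ be a nc functional Hilbert space on $\Omega$ with values in $\mathcal L(\mathcal A,\mathcal Y)_{\rm nc}$ with an $\mathcal A$-action. Assume that for all $n\in\mathbb N$, $Z\in\Omega_n$, there exists $\epsilon>0$ (independent of $f$) such that, for every $f\in\mathcal H$, $\|f(Z+D_Z)\|$ is defined and bounded over all $D_Z\in\mathcal V^{n\times n}$ with $\|D_Z\|<\epsilon$. Then the corresponding cp nc kernel $K$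 (the one with $\mathcal H=\mathcal H(K)$ isometrically) is $P$-locally bounded and $P$-locally completely bounded; more precisely, $\|K(Z+D_Z,Z+D_Z)(1_{\mathcal A^{n\times n}})\|=\|K(Z+D_Z,Z+D_Z)\|_{\rm cb}$ is defined and bounded over all $D_Z\in\mathcal V^{n\times n}$ with $\|D_Z\|<\epsilon$.
   Context: $\mathcal V_{\rm nc}=\coprod_{n\ge1}\mathcal V^{n\times n}$; $\Omega\subset\mathcal V_{\rm nc}$ is a nc set if closed under direct sums; $\Omega_n=\Omega\cap\mathcal V^{n\times n}$. An admissible family of matrix norms on $\mathcal V$ is a family of norms $\|\cdot\|_n$ on $\mathcal V^{n\times n}$ ($n\in\mathbb N$) such that for all $n,m$ there are constants $C_1,C_1'$ with $C_1^{-1}\max\{\|X\|_n,\|Y\|_m\}\le\|X\oplus Y\|_{n+m}\le C_1'\max\{\|X\|_n,\|Y\|_m\}$, and for each $n$ there is a constant $C_2$ with $\|SXT\|_n\le C_2\|S\|\|X\|_n\|T\|$ for $S,T\in\mathbb C^{n\times n}$ (operator spaces are an example). $\Omega$ is open in the disjoint union topology if for each $W\in\Omega_m$ there is $\epsilon>0$ with $W+D\in\Omega_m$ for all $D\in\mathcal V^{m\times m}$, $\|D\|<\epsilon$. $\mathcal L(\mathcal X,\mathcal Y)^{n\times n}\cong\mathcal L(\mathcal X^n,\mathcal Y^n)$ (bounded operators). A nc function $f\colon\Omega\to\mathcal L(\mathcal X,\mathcal Y)_{\rm nc}$ satisfies $f(Z)\in\mathcal L(\mathcal X,\mathcal Y)^{n\times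 n}$ for $Z\in\Omega_n$, and $\alpha f(Z)=f(\widetilde Z)\alpha$ whenever $Z\in\Omega_n$, $\widetilde Z\in\Omega_m$, $\alpha\in\mathbb C^{m\times n}$, $\alpha Z=\widetilde Z\alpha$. A nc kernel $K\colon\Omega\times\Omega\to\mathcal L(\mathcal A,\mathcal L(\mathcal Y))_{\rm nc}$ assigns to $Z\in\Omega_n$, $W\in\Omega_m$ a linear map $K(Z,W)\colon\mathcal A^{n\times m}\to\mathcal L(\mathcal Y)^{n\times m}$ such that $\alpha K(Z,W)(P)\beta^*=K(\widetilde Z,\widetilde W)(\alpha P\beta^* )$ whenever $\alpha Z=\widetilde Z\alpha$, $\beta W=\widetilde W\beta$ for $\alpha\in\mathbb C^{\tilde n\times n}$, $\beta\in\mathbb C^{\tilde m\times m}$, $\widetilde Z\in\Omega_{\tilde n}$, $\widetilde W\in\Omega_{\tilde m}$, $P\in\mathcal A^{n\times m}$. It is cp if $K(Z,Z)(P)\succeq0$ whenever $Z\in\Omega_n$, $P\succeq0$ in $\mathcal A^{n\times n}$. $\mathcal A^n$ denotes columns, $\mathcal A^{1\times m}$ rows; $v^*$ is conjugate transpose. For a cp nc kernel $K$, $\mathcal H(K)$ is the unique Hilbert space of nc functions $f\colon\Omega\to\mathcal L(\mathcal A,\mathcal Y)_{\rm nc}$ such that: (a) for $W\in\Omega_m$, $v\in\mathcal A^{1\times m}$, $y\in\mathcal Y^m$ the function $K_{W,v,y}(Z)u=K(Z,W)(uv)y$ ($Z\in\Omega_n$, $u\in\mathcal A^n$) belongs to $\mathcal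 H(K)$; (b) $\langle f(W)(v^* ),y\rangle_{\mathcal Y^m}=\langle f,K_{W,v,y}\rangle_{\mathcal H(K)}$; (c) $(\sigma(a)f)(W)(v^* )=f(W)(v^*a)$ defines a unital $*$-representation $\sigma$ of $\mathcal A$ on $\mathcal H(K)$. A Kolmogorov decomposition of $K$ consists of a Hilbert space $\mathcal X$, a unital $*$-representation $\sigma_{\mathcal X}\colon\mathcal A\to\mathcal L(\mathcal X)$ and a nc function $H\colon\Omega\to\mathcal L(\mathcal X,\mathcal Y)_{\rm nc}$ with $K(Z,W)(P)=H(Z)(\mathrm{id}_{\mathbb C^{n\times m}}\otimes\sigma_{\mathcal X})(P)H(W)^*$; it is minimal if $\{(\mathrm{id}_{\mathbb C^{1\times m}}\otimes\sigma_{\mathcal X})(v)H(W)^*y\colon W\in\Omega_m,v\in\mathcal A^{1\times m},y\in\mathcal Y^m,m\in\mathbb N\}$ has dense span in $\mathcal X$. A nc functional Hilbert space on $\Omega$ with values in $\mathcal L(\mathcal A,\mathcal Y)_{\rm nc}$ with an $\mathcal A$-action is a Hilbert space $\mathcal H$ of nc functions $f\colon\Omega\to\mathcal L(\mathcal A,\mathcal Y)_{\rm nc}$ such that each evaluation $f\mapsto f(W)\in\mathcal L(\mathcal A^m,\mathcal Y^m)$ ($W\in\Omega_m$) is bounded and $(\sigma(a)f)(W)(u)=f(W)(ua)$ ($u\in\mathcal A^m$) defines a unital $*$-representation of $\mathcal A$ on $\mathcal H$. Any such $\mathcal H$ is isometrically equal to $\mathcal H(K)$ for a unique cp nc kernel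 $K$. $K$ is $P$-locally bounded if for all $Z\in\Omega_n$, $W\in\Omega_m$, $P\in\mathcal A^{n\times m}$ there is $\epsilon>0$ such that $\|K(Z+D_Z,W+D_W)(P)\|$ is defined and uniformly bounded over all $D_Z\in\mathcal V^{n\times n}$, $D_W\in\mathcal V^{m\times m}$ with $\|D_Z\|,\|D_W\|<\epsilon$; $P$-locally completely bounded means the same with $\|K(Z+D_Z,W+D_W)\|_{\rm cb}$. A nc function $f$ is locally bounded (locally completely bounded) if for each $Z\in\Omega_n$ there is $\epsilon>0$ such that $\|f(Z+D_Z)\|$ (resp. $\|f(Z+D_Z)\|_{\rm cb}$) is defined and bounded over $\|D_Z\|<\epsilon$. The cb-norm of a linear map $\varphi$ between operator spaces is $\sup_N\|\mathrm{id}_{\mathbb C^{N\times N}}\otimes\varphi\|$; matrices over $\mathcal A$ carry their $C^*$-norms (for $\mathcal A\subset\mathcal L(\mathcal E)$, $\mathcal A^{p\times q}\subset\mathcal L(\mathcal E^q,\mathcal E^p)$, with $\mathcal A^m=\mathcal A^{m\times1}$), and Hilbert spaces carry the column operator space structure $\mathcal Y\cong\mathcal L(\mathbb C,\mathcal Y)$. *)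

(* Defs.v *)
From HB Require Import structures.
From mathcomp Require Import all_boot all_order all_algebra.
From mathcomp Require Import boolp classical_sets functions reals ereal.
From mathcomp Require Import topology normedtype.
From mathcomp.real_closed Require Export complex.

Set Implicit Arguments.
Unset Strict Implicit.
Unset Printing Implicit Defensive.

Import Order.TTheory GRing.Theory Num.Theory.
Import numFieldNormedType.Exports.

Local Open Scope classical_set_scope.
Local Open Scope ring_scope.

HB.mixin Record isHilbert (C : numClosedFieldType) X
    & CompleteNormedModule C X := {
  hdot : X -> X -> C;
  hdotPl : forall (a : C) (x y z : X),
    hdot (a *: x + y) z = a * hdot x z + hdot y z;
  hdotC : forall x y : X, hdot y x = (hdot x y)^*;
  hdotxx : forall x : X, hdot x x = `|x| ^+ 2
}.

#[short(type="hilbertType")]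
HB.structure Definition Hilbert (C : numClosedFieldType) :=
  {X of isHilbert C X & CompleteNormedModule C X}.

(* The product is a field of the structure, because a type cannot carry both
   the topological normed module structures and the ssralg ring structures
   unless it is a numFieldType: the two hierarchies have no common join. *)
HB.mixin Record isCStar (C : numClosedFieldType) A
    & CompleteNormedModule C A := {
  cmul : A -> A -> A;
  cone : A;
  star : A -> A;
  cmulA : associative cmul;
  cmul1x : left_id cone cmul;
  cmulx1 : right_id cone cmul;
  cmulPl : forall (a : C) (x y z : A),
    cmul (a *: x + y) z = a *: cmul x z + cmul y z;
  cmulPr : forall (a : C) (x y z : A),
    cmul z (a *: x + y) = a *: cmul z x + cmul z y;
  starK : involutive star;
  starP : forall (a : C) (x y : A), star (a *: x + y) = a^* *: star x + star y;
  starM : forall x y : A, star (cmul x y) = cmul (star y) (star x);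
  cnormM : forall x y : A, `|cmul x y| <= `|x| * `|y|;
  cnorm_star : forall x : A, `|cmul (star x) x| = `|x| ^+ 2
}.

#[short(type="cstarType")]
HB.structure Definition CStar (C : numClosedFieldType) :=
  {A of isCStar C A & CompleteNormedModule C A}.

Section BoundedOperators.
Variables (C : numClosedFieldType) (X Y : normedModType C).

Definition bounded_linear : {pred X -> Y} :=
  [pred f | `[< linear f /\ exists M : C, forall x, `|f x| <= M * `|x| >]].

Fact bounded_linear_submod : submod_closed bounded_linear.
Proof.
have E0 x : (0 : X -> Y) x = 0 by [].
split.
  apply/asboolP; split; first by move=> a x y; rewrite !E0 scaler0 addr0.
  by exists 0 => x; rewrite E0 normr0 mul0r.
move=> a f g /asboolP[lf [M hM]] /asboolP[lg [N hN]].
have E x : (a *: f + g) x = a *: f x + g x by [].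
apply/asboolP; split.
  move=> b x y; rewrite !E lf lg !scalerDr !scalerA (mulrC a b).
  by rewrite addrACA.
exists (`|a| * M + N) => x; rewrite E mulrDl -mulrA.
rewrite (le_trans (ler_normD _ _))// lerD// normrZ.
by rewrite ler_wpM2l.
Qed.

HB.instance Definition _ :=
  GRing.isSubmodClosed.Build C (X -> Y) bounded_linear bounded_linear_submod.

Record bop := Bop { bop_fun :> X -> Y; _ : bop_fun \in bounded_linear }.

HB.instance Definition _ := [isSub for bop_fun].
HB.instance Definition _ := [Choice of bop by <:].
HB.instance Definition _ := [SubChoice_isSubLmodule of bop by <:].

End BoundedOperators.

Section MatrixProducts.
Variables (U V : Type) (W : nmodType) (op : U -> V -> W).

Definition mxprod n k m (P : 'M[U]_(n, k)) (Q : 'M[V]_(k, m)) : 'M[W]_(n, m) :=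
  \matrix_(i, j) \sum_l op (P i l) (Q l j).

End MatrixProducts.

Section Actions.
Variables (C : numClosedFieldType).

Definition lscalemx (W : lmodType C) n k m
    (a : 'M[C]_(n, k)) (P : 'M[W]_(k, m)) : 'M[W]_(n, m) :=
  mxprod (fun c x => c *: x) a P.

Definition rscalemx (W : lmodType C) n k m
    (P : 'M[W]_(n, k)) (b : 'M[C]_(k, m)) : 'M[W]_(n, m) :=
  mxprod (fun x c => c *: x) P b.

Definition conjtr n m (b : 'M[C]_(n, m)) : 'M[C]_(m, n) :=
  map_mx Num.conj b^T.

Definition cmulmx (A : cstarType C) n k m
    (P : 'M[A]_(n, k)) (Q : 'M[A]_(k, m)) : 'M[A]_(n, m) :=
  mxprod (@cmul C A) P Q.

Definition starmx (A : cstarType C) n m (P : 'M[A]_(n, m)) : 'M[A]_(m, n) :=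
  map_mx (@star C A) P^T.

Definition cone_mx (A : cstarType C) n : 'M[A]_n :=
  \matrix_(i, j) (if i == j then cone else 0).

Definition applymx (X Y : normedModType C) n m
    (T : 'M[bop X Y]_(n, m)) (x : 'cV[X]_m) : 'cV[Y]_n :=
  mxprod (fun (t : bop X Y) x => t x) T x.

Definition cdot (X : hilbertType C) n (x y : 'cV[X]_n) : C :=
  \sum_i hdot (x i 0) (y i 0).

Definition is_adjoint (X Y : hilbertType C) n m
    (T : 'M[bop X Y]_(n, m)) (S : 'M[bop Y X]_(m, n)) : Prop :=
  forall x y, cdot (applymx T x) y = cdot x (applymx S y).

Definition star_rep (A : cstarType C) (X : hilbertType C)
    (sigma : A -> bop X X) : Prop :=
  [/\ forall (c : C) a b, sigma (c *: a + b) = c *: sigma a + sigma b,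
      forall a b x, sigma (cmul a b) x = sigma a (sigma b x),
      forall x, sigma cone x = x
    & forall a x y, hdot (sigma (star a) x) y = hdot x (sigma a y)].

Definition cstar_psd (A : cstarType C) n (P : 'M[A]_n) : Prop :=
  exists Q : 'M[A]_n, P = cmulmx (starmx Q) Q.

Definition op_psd (X : hilbertType C) n (T : 'M[bop X X]_n) : Prop :=
  forall x, 0 <= cdot (applymx T x) x.

Definition lspan (X : lmodType C) (S : set X) : set X :=
  [set x | exists n (c : 'I_n -> C) (s : 'I_n -> X),
     (forall i, S (s i)) /\ x = \sum_i c i *: s i].

End Actions.

Infix "*sm" := lscalemx (at level 40, left associativity).
Infix "*ms" := rscalemx (at level 40, left associativity).
Infix "*cm" := cmulmx (at level 40, left associativity).
Infix "*v" := applymx (at level 40, left associativity).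
Notation "b ^H" := (conjtr b) (at level 8, format "b ^H").

Section Norms.
Variable R : realType.
Local Notation C := (R[i]).

Definition rnorm (X : normedModType C) (x : X) : R := complex.Re `|x|.

Definition l2norm (X : normedModType C) (I : finType) (x : I -> X) : R :=
  Num.sqrt (\sum_i rnorm (x i) ^+ 2).

Definition opnorm (E F : Type) (nE : E -> \bar R) (nF : F -> \bar R)
    (phi : E -> F) : \bar R :=
  ereal_sup [set nF (phi x) | x in [set x | (nE x <= 1)%E]].

(* Norm of the operator X^J -> Y^I given by an I x J matrix of operators; the
   index sets are arbitrary finite types, so that block matrices are covered
   without flattening the pairs of indices. *)
Definition mxopnorm (X Y : normedModType C) (I J : finType)
    (T : I -> J -> X -> Y) : \bar R :=
  opnorm (fun x : J -> X => (l2norm x)%:E) (fun y : I -> Y => (l2norm y)%:E)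
    (fun x i => \sum_j T i j (x j)).

Definition scalarmx_norm n m (S : 'M[C]_(n, m)) : \bar R :=
  mxopnorm (fun i j (x : C^o) => S i j *: x).

Definition opmx_norm (X Y : normedModType C) n m (T : 'M[bop X Y]_(n, m)) :=
  mxopnorm (fun i j => T i j : X -> Y).

Definition col_norm (X : normedModType C) n (x : 'cV[X]_n) : \bar R :=
  (l2norm (fun i => x i 0))%:E.

(* For an isometric representation iota of A on E, i.e. A inside L(E), this is
   the norm of A^(n x m) inside L(E^m, E^n). Such an iota always exists by
   Gelfand-Naimark, and the norm does not depend on its choice. *)
Definition cstar_norm (A : cstarType C) (E : hilbertType C)
    (iota : A -> bop E E) n m (P : 'M[A]_(n, m)) : \bar R :=
  opmx_norm (map_mx iota P).

Definition matrix_norms (F : Type) := forall N, 'M[F]_N -> \bar R.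

(* (L(X, Y)^(n x m))^(N x N) = L(X^(N m), Y^(N n)) *)
Definition op_mnorms (X Y : normedModType C) n m :
    matrix_norms 'M[bop X Y]_(n, m) := fun N B =>
  mxopnorm (fun (i : 'I_N * 'I_n) (j : 'I_N * 'I_m) =>
    B i.1 j.1 i.2 j.2 : X -> Y).

Definition cstar_mnorms (A : cstarType C) (E : hilbertType C)
    (iota : A -> bop E E) n m : matrix_norms 'M[A]_(n, m) := fun N B =>
  op_mnorms (map_mx (map_mx iota) B).

(* Column operator space structure: (X^n)^(N x N) = L(C^N, X^(N n)). *)
Definition col_mnorms (X : hilbertType C) n :
    matrix_norms 'cV[X]_n := fun N B =>
  mxopnorm (fun (i : 'I_N * 'I_n) (j : 'I_N) (c : C^o) => c *: B i.1 j i.2 0).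

Definition cbnorm (F G : Type) (nF : matrix_norms F) (nG : matrix_norms G)
    (phi : F -> G) : \bar R :=
  ereal_sup [set opnorm (nF N) (nG N) (map_mx phi) | N in [set N | 0 < N]%N].

End Norms.

Section NcFunctions.
Variables (R : realType).
Local Notation C := (R[i]).
Variables (V : completeNormedModType C).

Record is_mxnorm n (nrm : 'M[V]_n -> R) : Prop := {
  mxnorm_eq0 : forall X, nrm X = 0 -> X = 0;
  mxnormZ : forall (a : C) X,
    nrm (map_mx (fun x => a *: x) X) = complex.Re `|a| * nrm X;
  mxnormD : forall X Y, nrm (X + Y) <= nrm X + nrm Y
}.

(* The matrices of size 0 are not part of V_nc, hence the positivity
   conditions on the sizes. *)
Record admissible (nrm : forall n, 'M[V]_n -> R) : Prop := {
  adm_norm : forall n, (0 < n)%N -> is_mxnorm (@nrm n);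
  adm_dsum : forall n m, (0 < n)%N -> (0 < m)%N ->
    exists C1 C1' : R, [/\ 0 < C1, 0 < C1' &
      forall (X : 'M[V]_n) (Y : 'M[V]_m),
        C1^-1 * Num.max (nrm n X) (nrm m Y) <=
          nrm (n + m)%N (block_mx X 0 0 Y) <=
        C1' * Num.max (nrm n X) (nrm m Y)];
  adm_mul : forall n, (0 < n)%N ->
    exists2 C2 : R, 0 < C2 & forall (S T : 'M[C]_n) (X : 'M[V]_n),
      ((nrm n (S *sm X *ms T))%:E <=
        C2%:E * scalarmx_norm S * (nrm n X)%:E * scalarmx_norm T)%E
}.

Record is_ncset (Omega : forall n, set 'M[V]_n) : Prop := {
  ncset_pos : forall n Z, Omega n Z -> (0 < n)%N;
  ncset_dsum : forall n m Z W, Omega n Z -> Omega m W ->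
    Omega (n + m)%N (block_mx Z 0 0 W)
}.

Definition nc_open (nrm : forall n, 'M[V]_n -> R)
    (Omega : forall n, set 'M[V]_n) : Prop :=
  forall m W, Omega m W -> exists2 eps : R, 0 < eps &
    forall D, nrm m D < eps -> Omega m (W + D).

Variables (nrm : forall n, 'M[V]_n -> R) (Omega : forall n, set 'M[V]_n).

(* Functions on Omega are functions on all matrices over V, of which only the
   values on Omega matter. *)
Definition is_ncfun (X Y : normedModType C)
    (f : forall n, 'M[V]_n -> 'M[bop X Y]_n) : Prop :=
  forall n m (Z : 'M[V]_n) (Z' : 'M[V]_m) (a : 'M[C]_(m, n)),
    Omega Z -> Omega Z' -> a *sm Z = Z' *ms a -> a *sm f n Z = f m Z' *ms a.

Definition bounded_on_ball n (Z : 'M[V]_n) (eps : R)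
    (g : 'M[V]_n -> \bar R) : Prop :=
  exists M : R, forall D, nrm D < eps ->
    Omega (Z + D) /\ (g (Z + D)%R <= M%:E)%E.

Definition locally_bounded (g : forall n, 'M[V]_n -> \bar R) : Prop :=
  forall n (Z : 'M[V]_n), Omega Z ->
    exists2 eps : R, 0 < eps & bounded_on_ball Z eps (g n).

Section Kernels.
Variables (A : cstarType C) (Y : hilbertType C).

Definition kernel := forall n m, 'M[V]_n -> 'M[V]_m ->
  'M[A]_(n, m) -> 'M[bop Y Y]_(n, m).

Record is_cp_nckernel (K : kernel) : Prop := {
  nckernel_linear : forall n m (Z : 'M[V]_n) (W : 'M[V]_m),
    Omega Z -> Omega W -> forall (c : C) (P Q : 'M[A]_(n, m)),
      K n m Z W (map_mx (fun a => c *: a) P + Q) =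
      map_mx (fun t => c *: t) (K n m Z W P) + K n m Z W Q;
  nckernel_intertwine : forall n m n' m'
      (Z : 'M[V]_n) (W : 'M[V]_m) (Z' : 'M[V]_n') (W' : 'M[V]_m')
      (a : 'M[C]_(n', n)) (b : 'M[C]_(m', m)) (P : 'M[A]_(n, m)),
    Omega Z -> Omega W -> Omega Z' -> Omega W' ->
    a *sm Z = Z' *ms a -> b *sm W = W' *ms b ->
    a *sm K n m Z W P *ms b^H = K n' m' Z' W' (a *sm P *ms b^H);
  nckernel_cp : forall n (Z : 'M[V]_n) (P : 'M[A]_n),
    Omega Z -> cstar_psd P -> op_psd (K n n Z Z P)
}.

(* A Hilbert space of functions is a Hilbert space X with an injective linear
   map ev, which sends an element of X to the function it stands for. *)
Record is_ncfun_space (X : hilbertType C) (sigma : A -> bop X X)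
    (ev : X -> forall n, 'M[V]_n -> 'M[bop A Y]_n) : Prop := {
  ev_linear : forall (c : C) f g n (Z : 'M[V]_n), Omega Z ->
    ev (c *: f + g) n Z = map_mx (fun t => c *: t) (ev f n Z) + ev g n Z;
  ev_inj : forall f g,
    (forall n (Z : 'M[V]_n), Omega Z -> ev f n Z = ev g n Z) -> f = g;
  ev_ncfun : forall f, is_ncfun (ev f);
  action_rep : star_rep sigma;
  actionE : forall (a : A) f n (W : 'M[V]_n) (u : 'cV[A]_n), Omega W ->
    ev (sigma a f) n W *v u = ev f n W *v map_mx (fun b => cmul b a) u
}.

Record is_rkhs (K : kernel) (X : hilbertType C) (sigma : A -> bop X X)
    (ev : X -> forall n, 'M[V]_n -> 'M[bop A Y]_n) : Prop := {
  rkhs_space : is_ncfun_space sigma ev;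
  rkhs_kernel : forall m (W : 'M[V]_m) (v : 'rV[A]_m) (y : 'cV[Y]_m),
    Omega W -> exists k : X,
      (forall n (Z : 'M[V]_n) (u : 'cV[A]_n), Omega Z ->
         ev k n Z *v u = K n m Z W (u *cm v) *v y) /\
      (forall f, cdot (ev f m W *v starmx v) y = hdot f k)
}.

Record is_min_kolmogorov (K : kernel) (X : hilbertType C)
    (sigma : A -> bop X X) (H : forall n, 'M[V]_n -> 'M[bop X Y]_n) : Prop := {
  kolmo_rep : star_rep sigma;
  kolmo_ncfun : is_ncfun H;
  kolmo_factor : forall n m (Z : 'M[V]_n) (W : 'M[V]_m), Omega Z -> Omega W ->
    exists2 HW : 'M[bop Y X]_m, is_adjoint (H m W) HW &
      forall (P : 'M[A]_(n, m)) (y : 'cV[Y]_m),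
        K n m Z W P *v y = H n Z *v (map_mx sigma P *v (HW *v y));
  kolmo_min : dense (lspan [set x : X |
    exists m (W : 'M[V]_m) (HW : 'M[bop Y X]_m) (v : 'rV[A]_m) (y : 'cV[Y]_m),
      [/\ Omega W, is_adjoint (H m W) HW &
          x = (map_mx sigma v *v (HW *v y)) 0 0]])
}.

Variables (E : hilbertType C) (iota : A -> bop E E).

(* T stands for an operator A^n -> Y^n, where A^n = A^(n x 1). *)
Definition fun_norm n (T : 'M[bop A Y]_n) : \bar R :=
  opnorm (fun u : 'cV[A]_n => cstar_norm iota u) (@col_norm _ Y n) (applymx T).

Definition fun_cbnorm n (T : 'M[bop A Y]_n) : \bar R :=
  cbnorm (cstar_mnorms iota (n := n) (m := 1)) (@col_mnorms _ Y n) (applymx T).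

Definition factor_cbnorm (X : hilbertType C) n (T : 'M[bop X Y]_n) : \bar R :=
  cbnorm (@col_mnorms _ X n) (@col_mnorms _ Y n) (applymx T).

Definition kernel_cbnorm n m (k : 'M[A]_(n, m) -> 'M[bop Y Y]_(n, m)) :
    \bar R :=
  cbnorm (cstar_mnorms iota (n := n) (m := m)) (@op_mnorms _ Y Y n m) k.

Definition P_locally_bounded (K : kernel) : Prop :=
  forall n m (Z : 'M[V]_n) (W : 'M[V]_m) (P : 'M[A]_(n, m)),
    Omega Z -> Omega W ->
    exists2 eps : R, 0 < eps & exists M : R, forall DZ DW,
      nrm DZ < eps -> nrm DW < eps ->
      [/\ Omega (Z + DZ), Omega (W + DW) &
          (opmx_norm (K n m (Z + DZ)%R (W + DW)%R P) <= M%:E)%E].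

Definition P_locally_cb (K : kernel) : Prop :=
  forall n m (Z : 'M[V]_n) (W : 'M[V]_m), Omega Z -> Omega W ->
    exists2 eps : R, 0 < eps & exists M : R, forall DZ DW,
      nrm DZ < eps -> nrm DW < eps ->
      [/\ Omega (Z + DZ), Omega (W + DW) &
          (kernel_cbnorm (K n m (Z + DZ)%R (W + DW)%R) <= M%:E)%E].

Record is_ncfun_hilbert (X : hilbertType C) (sigma : A -> bop X X)
    (ev : X -> forall n, 'M[V]_n -> 'M[bop A Y]_n) : Prop := {
  ncfun_hilbert_space : is_ncfun_space sigma ev;
  ncfun_hilbert_bounded : forall n (W : 'M[V]_n), Omega W ->
    exists M : R, forall f, (fun_norm (ev f n W) <= (M * rnorm f)%:E)%E
}.

End Kernels.

End NcFunctions.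

(* Main.v *)
(** In terms of a factorization K(Z,W)(P) = H(Z) sigma(P) H(W)^*, with sigma
    acting entrywise, the bound ||K(Z,Z)(1)|| <= M says exactly that
    ||H(Z)^*|| <= sqrt M.  Every claim then follows from the fact that sigma is
    completely contractive: <f(W)u, y> = <f, sigma(v) H(W)^* y>, with v = u^* a row,
    bounds f(W) and its amplifications by ||f|| sqrt M, and the factorization
    itself bounds ||K(Z,W)||_cb by ||H(Z)|| ||H(W)||.  The reproducing kernel
    space is its own factorization, H(W)^* y having the entries K_{W,e_j,y}.  In
    the converse direction the vectors K_{W,e_j,y}, with W in the ball and
    ||y|| <= 1, are weakly bounded, hence bounded.

    Only real parts of inner products are used ([rdot], [fdot]): each estimate
    pairs a vector with itself or with its image. *)
Require Import Defs.
From mathcomp Require Import all_boot all_order all_algebra.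
From mathcomp Require Import boolp classical_sets functions reals ereal.
From mathcomp Require Import topology normedtype.
From mathcomp Require Import ring lra.

Set Implicit Arguments.
Unset Strict Implicit.
Unset Printing Implicit Defensive.

Import Order.TTheory GRing.Theory Num.Theory.
Import numFieldNormedType.Exports.

Local Open Scope classical_set_scope.
Local Open Scope ring_scope.

(** * Growth and decay of real powers *)

Section RealSequences.
Variable R : realType.

Lemma exprn_unbounded (r K : R) : 1 < r -> exists n, K < r ^+ n.
Proof.
move=> r1; have bern n : 1 + n%:R * (r - 1) <= r ^+ n.
  elim: n => [|n IH]; first by rewrite expr0 mul0r addr0.
  rewrite exprS; apply: (le_trans _ (ler_wpM2l (ltW (lt_trans ltr01 r1)) IH)).
  have : 0 <= n%:R * (r - 1) ^+ 2 by rewrite mulr_ge0 ?sqr_ge0.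
  by rewrite -natr1; nra.
have rB : 0 < r - 1 by rewrite subr_gt0.
set x := `|K| / (r - 1); exists (Num.bound x).
apply: lt_le_trans (bern _).
have := @archi_boundP _ x (divr_ge0 (normr_ge0 K) (ltW rB)).
rewrite ltr_pdivrMr// => h; have := ler_norm K; lra.
Qed.

Lemma le0_geometric (x K q : R) :
  0 <= q < 1 -> (forall n, x <= K * q ^+ n) -> x <= 0.
Proof.
move=> /andP[q0 q1] h; rewrite leNgt; apply/negP => x0.
have K0 : 0 < K by have := h 0%N; rewrite expr0 mulr1 => /(lt_le_trans x0).
have qp : 0 < q.
  rewrite lt_neqAle q0 andbT; apply/eqP => qE; have := h 1%N.
  by rewrite -qE expr1 mulr0 leNgt x0.
have [|n] := @exprn_unbounded q^-1 (K / x); first by rewrite invf_gt1.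
rewrite exprVn ltr_pdivrMr// mulrC ltr_pdivlMr ?exprn_gt0// => hn.
by have := h n; rewrite leNgt hn.
Qed.

(** The [2^k]-th roots of a positive [K] tend to 1, so a constant independent of [k] disappears.
    Exponents [2^k] are those that repeated squaring produces. *)
Lemma le_pow2_root (a b K : R) : 0 <= b ->
  (forall k, a ^+ (2 ^ k) <= K * b ^+ (2 ^ k)) -> a <= b.
Proof.
move=> b0 h; rewrite leNgt; apply/negP => ab.
have a0 := le_lt_trans b0 ab.
have K0 : 0 < K.
  rewrite ltNge; apply/negP => K0; have := h 0%N; rewrite !expr1.
  by have := mulr_le0_ge0 K0 b0; lra.
move: b0; rewrite le_eqVlt => /orP[/eqP bE|bp].
  by have := h 0%N; rewrite !expr1 -bE mulr0 leNgt a0.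
have [|n] := @exprn_unbounded (a / b) K; first by rewrite ltr_pdivlMr// mul1r.
have := h n; rewrite -ler_pdivrMr ?exprn_gt0// -expr_div_n => h1 h2.
have ab1 : 1 <= a / b by rewrite ler_pdivlMr// mul1r ltW.
have := ler_weXn2l ab1 (ltnW (ltn_expl n (ltnSn 1))).
by move=> /(lt_le_trans h2) /lt_le_trans /(_ h1); rewrite ltxx.
Qed.

End RealSequences.

(** * Real norms and inner products, uniform boundedness *)

Section RealNorm.
Variable R : realType.
Local Notation C := (R[i]).
Local Open Scope complex_scope.

Lemma rnormE (X : normedModType C) (x : X) : `|x| = (rnorm x)%:C.
Proof. by rewrite /rnorm RRe_real// ger0_real. Qed.

Section Normed.
Variable X : normedModType C.
Implicit Types x y : X.

Lemma rnorm_ge0 x : 0 <= rnorm x.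
Proof. by rewrite -ler0c -rnormE. Qed.

Lemma rnorm0 : rnorm (0 : X) = 0.
Proof. by rewrite /rnorm normr0. Qed.

Lemma rnorm0_eq0 x : rnorm x = 0 -> x = 0.
Proof. by move=> x0; apply/normr0_eq0; rewrite rnormE x0. Qed.

Lemma rnormD x y : rnorm (x + y) <= rnorm x + rnorm y.
Proof. by rewrite -lecR rmorphD/= -!rnormE ler_normD. Qed.

Lemma rnormN x : rnorm (- x) = rnorm x.
Proof. by rewrite /rnorm normrN. Qed.

Lemma rnormZ (c : C^o) x : rnorm (c *: x) = rnorm c * rnorm x.
Proof. by apply: complexI; rewrite rmorphM/= -!rnormE normrZ. Qed.

Lemma rnormR (t : R) : rnorm (t%:C : C^o) = `|t|.
Proof.
apply: complexI; rewrite -rnormE -[LHS]/(`|t%:C : C|) normc_def/=.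
by rewrite expr0n/= addr0 sqrtr_sqr.
Qed.

Lemma rnormZR (t : R) x : rnorm (t%:C *: x) = `|t| * rnorm x.
Proof. by rewrite rnormZ rnormR. Qed.

Lemma rnorm_sum (I : finType) (F : I -> X) :
  rnorm (\sum_i F i) <= \sum_i rnorm (F i).
Proof.
elim/big_ind2: _ => [|x a y b xa yb|//]; first by rewrite rnorm0.
by rewrite (le_trans (rnormD _ _))// lerD.
Qed.

End Normed.

(** Convergence comes with a rate at every index: the gliding hump compares the limit with a single
    partial sum, and the square root passes to the limit by letting [q ^+ n] decay. *)
Lemma geometric_cvg (X : completeNormedModType C) (u : nat -> X) (K q : R) :
  0 <= q < 1 -> (forall n, rnorm (u n.+1 - u n) <= K * q ^+ n) ->
  exists l, forall n, rnorm (l - u n) <= K / (1 - q) * q ^+ n.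
Proof.
move=> /andP[q0 q1] hu; have qB : 0 < 1 - q by rewrite subr_gt0.
have K0 : 0 <= K.
  by have := hu 0%N; rewrite expr0 mulr1; apply: le_trans; exact: rnorm_ge0.
(* Keeping the subtracted term [q ^+ (n + k)] makes the partial geometric sum exact, so that the
   induction on [k] closes. *)
have tail n k : rnorm (u (n + k)%N - u n) <= K / (1 - q) * (q ^+ n - q ^+ (n + k)).
  elim: k => [|k IH]; first by rewrite addn0 !subrr mulr0 rnorm0.
  rewrite addnS -(subrKA (u (n + k)%N)).
  apply: (le_trans (rnormD _ _)); apply: (le_trans (lerD (hu _) IH)).
  rewrite exprS le_eqVlt; apply/orP; left; apply/eqP; field.
  by rewrite gt_eqF.
have le n m : (n <= m)%N -> rnorm (u m - u n) <= K / (1 - q) * q ^+ n.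
  move=> /subnKC<-; apply: (le_trans (tail _ _)).
  rewrite ler_wpM2l ?divr_ge0 ?(ltW qB)//.
  by rewrite lerBlDr lerDl exprn_ge0.
have small (e : R) : 0 < e -> exists n, K / (1 - q) * q ^+ n < e.
  move=> e0; apply: contrapT => /forallNP h.
  have := @le0_geometric _ e (K / (1 - q)) q; rewrite q0 q1 => /(_ isT).
  move=> /(_ (fun n => _)) h'; suff : e <= 0 by rewrite leNgt e0.
  by apply: h' => n; rewrite leNgt; apply/negP.
have cu : cvg (u @ \oo).
  apply: cauchy_cvg; apply: cauchy_exP => e e0.
  have eE : e = (complex.Re e)%:C by rewrite RRe_real// gtr0_real.
  have [|n hn] := small (complex.Re e); first by rewrite -ltcR -eE.
  exists (u n), n => // m /= nm; rewrite -ball_normE/= -opprB normrN rnormE eE.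
  by rewrite ltcR; apply: le_lt_trans hn; apply: le.
exists (lim (u @ \oo)) => n; apply/ler_addgt0Pl => e e0.
have /cvgrPdist_lt/(_ e%:C) := cu; rewrite ltcR => /(_ e0)[m _ hm].
set k := maxn m n; rewrite -(subrKA (u k)) (le_trans (rnormD _ _))// lerD//.
  by rewrite -lecR -rnormE ltW//; apply: hm; rewrite /= leq_maxl.
by rewrite le// leq_maxr.
Qed.

Section RealDot.
Variable X : hilbertType C.
Implicit Types x y z : X.

Definition rdot x y : R := complex.Re (hdot x y).

Lemma rdotPl (t : R) x y z : rdot (t%:C *: x + y) z = t * rdot x z + rdot y z.
Proof.
rewrite /rdot hdotPl; case: (hdot x z) (hdot y z) => [a b] [c d] /=.
by rewrite mul0r subr0.
Qed.

Lemma rdotC x y : rdot x y = rdot y x.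
Proof. by rewrite /rdot hdotC; case: hdot. Qed.

Lemma rdotxx x : rdot x x = rnorm x ^+ 2.
Proof. by rewrite /rdot hdotxx rnormE -rmorphXn. Qed.

Lemma rdotDl x y z : rdot (x + y) z = rdot x z + rdot y z.
Proof. by have := rdotPl 1 x y z; rewrite rmorph1 scale1r mul1r. Qed.

Lemma rdot0l z : rdot 0 z = 0.
Proof. by have := rdotDl 0 0 z; rewrite addr0; lra. Qed.

Lemma rdotZl (t : R) x z : rdot (t%:C *: x) z = t * rdot x z.
Proof. by rewrite -[_ *: _]addr0 rdotPl rdot0l addr0. Qed.

Lemma rdotNl x z : rdot (- x) z = - rdot x z.
Proof. by have := rdotDl x (- x) z; rewrite subrr rdot0l; lra. Qed.

Lemma rdotBl x y z : rdot (x - y) z = rdot x z - rdot y z.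
Proof. by rewrite rdotDl rdotNl. Qed.

Lemma rdotZr (t : R) x z : rdot z (t%:C *: x) = t * rdot z x.
Proof. by rewrite rdotC rdotZl rdotC. Qed.

Lemma rdotBr x y z : rdot z (x - y) = rdot z x - rdot z y.
Proof. by rewrite rdotC rdotBl !(rdotC z). Qed.

Lemma rdot_suml (I : finType) (F : I -> X) z :
  rdot (\sum_i F i) z = \sum_i rdot (F i) z.
Proof.
by elim/big_ind2: _ => [|x a y b <- <-|//]; rewrite ?rdot0l ?rdotDl.
Qed.

Lemma rdot_sumr (I : finType) (F : I -> X) z :
  rdot z (\sum_i F i) = \sum_i rdot z (F i).
Proof. by rewrite rdotC rdot_suml; apply: eq_bigr => i _; rewrite rdotC. Qed.

End RealDot.

Section L2.
Variables (X : normedModType C) (I : finType).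
Implicit Types x y : I -> X.

Lemma l2norm_ge0 x : 0 <= l2norm x.
Proof. exact: sqrtr_ge0. Qed.

Lemma sqr_l2norm x : l2norm x ^+ 2 = \sum_i rnorm (x i) ^+ 2.
Proof. by rewrite sqr_sqrtr// sumr_ge0// => i _; rewrite sqr_ge0. Qed.

Lemma rnorm_le_l2norm x i : rnorm (x i) <= l2norm x.
Proof.
rewrite -(ler_pXn2r (ltn0Sn 1)) ?nnegrE ?rnorm_ge0 ?l2norm_ge0//.
by rewrite sqr_l2norm (bigD1 i)//= lerDl sumr_ge0// => j _; rewrite sqr_ge0.
Qed.

Lemma l2norm_eq0 x i : l2norm x = 0 -> x i = 0.
Proof.
move=> x0; apply: rnorm0_eq0; apply: le_anti.
by rewrite rnorm_ge0 andbT -x0 rnorm_le_l2norm.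
Qed.

Lemma l2normZ (c : C^o) x : l2norm (fun i => c *: x i) = rnorm c * l2norm x.
Proof.
rewrite /l2norm -(ger0_norm (rnorm_ge0 c)) -sqrtr_sqr -sqrtrM ?sqr_ge0//.
by rewrite mulr_sumr; congr Num.sqrt; apply: eq_bigr => i _; rewrite rnormZ exprMn.
Qed.

Lemma l2norm_cst0 : l2norm (fun _ : I => 0 : X) = 0.
Proof.
by rewrite /l2norm big1 ?sqrtr0// => i _; rewrite rnorm0 expr0n.
Qed.

Lemma l2norm_le_sum x : l2norm x <= \sum_i rnorm (x i).
Proof.
have S0 : 0 <= \sum_i rnorm (x i) by rewrite sumr_ge0// => i _; rewrite rnorm_ge0.
rewrite -(ler_pXn2r (ltn0Sn 1)) ?nnegrE ?l2norm_ge0// sqr_l2norm expr2 mulr_suml.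
apply: ler_sum => i _; rewrite expr2 ler_wpM2l ?rnorm_ge0//.
by rewrite (bigD1 i)//= lerDl sumr_ge0// => j _; rewrite rnorm_ge0.
Qed.

End L2.

Lemma l2norm_reindex (X : normedModType C) (I J : finType) (f : J -> I)
  (x : I -> X) : bijective f -> l2norm (x \o f) = l2norm x.
Proof. by move=> bf; rewrite /l2norm [in RHS](reindex f)//; exact: onW_bij. Qed.

Lemma l2norm_pair (X : normedModType C) (I J : finType) (x : I * J -> X) :
  l2norm x ^+ 2 = \sum_i l2norm (fun j => x (i, j)) ^+ 2.
Proof.
rewrite sqr_l2norm; under [in RHS]eq_bigr do rewrite sqr_l2norm.
by rewrite pair_bigA/=; apply: eq_bigr => -[].
Qed.

Section Fdot.
Variables (X : hilbertType C) (I : finType).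
Implicit Types x y : I -> X.

Definition fdot x y : R := \sum_i rdot (x i) (y i).

Lemma fdotC x y : fdot x y = fdot y x.
Proof. by apply: eq_bigr => i _; rewrite rdotC. Qed.

Lemma fdotxx x : fdot x x = l2norm x ^+ 2.
Proof. by rewrite sqr_l2norm; apply: eq_bigr => i _; rewrite rdotxx. Qed.

(** Cauchy-Schwarz, from expanding [|b x - a y|^2 >= 0] with [a = |x|], [b = |y|] and dividing by
    [a b]; hence vanishing norms are treated first. *)
Lemma fdot_le x y : fdot x y <= l2norm x * l2norm y.
Proof.
have := l2norm_ge0 x; rewrite le_eqVlt => /orP[/eqP/esym x0|x0].
  rewrite /fdot big1 ?x0 ?mul0r// => i _.
  by rewrite (l2norm_eq0 _ x0) rdot0l.
have := l2norm_ge0 y; rewrite le_eqVlt => /orP[/eqP/esym y0|y0].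
  rewrite /fdot big1 ?y0 ?mulr0// => i _.
  by rewrite (l2norm_eq0 _ y0) rdotC rdot0l.
set a := l2norm x in x0 *; set b := l2norm y in y0 *.
have : 0 <= \sum_i rnorm (b%:C *: x i - a%:C *: y i) ^+ 2.
  by rewrite sumr_ge0// => i _; rewrite sqr_ge0.
under eq_bigr => i _.
  rewrite (_ : _ ^+ 2 = b ^+ 2 * rnorm (x i) ^+ 2 + a ^+ 2 * rnorm (y i) ^+ 2 -
                        2 * (a * b) * rdot (x i) (y i)); last first.
    rewrite -rdotxx rdotBl !rdotBr !rdotZl !rdotZr !rdotxx (rdotC (y i)); ring.
  over.
rewrite sumrB big_split/= -!mulr_sumr -!sqr_l2norm -/a -/b -/(fdot x y).
have ab : 0 < a * b by rewrite mulr_gt0.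
by move=> h; rewrite -(ler_pM2l ab); nra.
Qed.

End Fdot.

Lemma rdot_le (X : hilbertType C) (x y : X) : rdot x y <= rnorm x * rnorm y.
Proof.
have unitE (F : unit -> R) : \sum_i F i = F tt.
  by rewrite (bigD1 tt)//= big1 ?addr0// => -[].
have := @fdot_le X unit (fun=> x) (fun=> y).
by rewrite /fdot /l2norm !unitE !sqrtr_sqr !ger0_norm ?rnorm_ge0.
Qed.

(* A gliding hump in the style of Sokal: the step [3^-n] in the direction of
   [s_n], with [|s_n| >= 4^n], cannot be undone by the later steps. *)
Lemma weakly_bounded_bounded (X : hilbertType C) (S : set X) :
  (forall f, exists M : R, forall s, S s -> rdot f s <= M) ->
  exists M : R, forall s, S s -> rnorm s <= M.
Proof.
move=> wb; apply: contrapT => /forallNP unb.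
have big (M : R) : {s | S s /\ M < rnorm s}.
  apply: cid; have /existsNP[s /not_implyP[Ss /negP]] := unb M.
  by rewrite -ltNge; exists s.
pose s n := sval (big (4 ^+ n)).
have Ss n : S (s n) by case: (svalP (big (4 ^+ n))).
have sn n : 4 ^+ n < rnorm (s n) by case: (svalP (big (4 ^+ n))).
pose q : R := 3^-1.
(* The sign is that of the pairing accumulated so far, so the jump adds to it:
   [|<u_(n+1), s_n>| >= q^n |s_n|]. *)
pose sg x n : R := if 0 <= rdot x (s n) then 1 else -1.
pose u := fix u n := if n is m.+1 then
  u m + (sg (u m) m * q ^+ m / rnorm (s m))%:C *: s m else 0.
have s0 n : 0 < rnorm (s n) by apply: le_lt_trans (sn n); rewrite exprn_ge0.
have q0 : 0 <= q by rewrite /q; lra.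
have q1 : q < 1 by rewrite /q; lra.
have sgN x n : `|sg x n| = 1.
  by rewrite /sg; case: ifP => _; rewrite ?normrN normr1.
have step n : rnorm (u n.+1 - u n) <= 1 * q ^+ n.
  rewrite /= addrC addKr rnormZR !normrM sgN mul1r normfV.
  rewrite (ger0_norm (exprn_ge0 _ q0)) (ger0_norm (ltW (s0 n))).
  by rewrite divfK ?gt_eqF// mul1r.
have [|l hl] := @geometric_cvg X u 1 q _ step; first by rewrite q0.
(* All steps after the [n]-th together move the sequence by at most [q^(n+1) / (1 - q) = q^n / 2],
   half of the jump. *)
have lb n : (q ^+ n / 2) * rnorm (s n) <= `|rdot l (s n)|.
  have h1 : q ^+ n * rnorm (s n) <= `|rdot (u n.+1) (s n)|.
    rewrite /= rdotDl rdotZl rdotxx.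
    have -> : sg (u n) n * q ^+ n / rnorm (s n) * rnorm (s n) ^+ 2 =
              sg (u n) n * (q ^+ n * rnorm (s n)).
      by rewrite expr2 mulrA divfK ?gt_eqF// mulrA.
    rewrite /sg.
    have : 0 <= q ^+ n * rnorm (s n) by rewrite mulr_ge0 ?exprn_ge0// ltW.
    move: (q ^+ n * rnorm (s n)) (rdot (u n) (s n)) => p r p0.
    case: ifPn => [r0|]; first by rewrite mul1r ger0_norm; lra.
    by rewrite -ltNge => r0; rewrite mulN1r ler0_norm; lra.
  have h2 : `|rdot (u n.+1 - l) (s n)| <= (q ^+ n / 2) * rnorm (s n).
    have hn : rnorm (l - u n.+1) <= q ^+ n / 2.
      have := hl n.+1; rewrite exprS (_ : 1 / (1 - q) = 3 / 2) /q; last by field.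
      by move: (3^-1 ^+ n) => z; lra.
    apply: (@le_trans _ _ (rnorm (l - u n.+1) * rnorm (s n))); last first.
      by rewrite ler_wpM2r// ltW.
    rewrite ler_norml -[u n.+1 - l]opprB; apply/andP; split.
      by rewrite rdotNl lerN2 rdot_le.
    by rewrite (le_trans (rdot_le _ _))// rnormN.
  rewrite rdotBl in h2.
  have := ler_normD (rdot (u n.+1) (s n) - rdot l (s n)) (rdot l (s n)).
  by rewrite subrK; lra.
(* The hypothesis bounds pairings from above only, so it is applied to both [l] and [- l]. It
   contradicts [q^n |s_n| >= (4/3)^n], which comes from [|s_n| > 4^n]. *)
have [M1 hM1] := wb l; have [M2 hM2] := wb (- l).
have r1 : 1 < (4 / 3 : R) by lra.
have [n hn] := @exprn_unbounded R (4 / 3) (2 * (`|M1| + `|M2|)) r1.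
have h1 := hM1 _ (Ss n); have h2 := hM2 _ (Ss n); rewrite rdotNl in h2.
have h3 : `|rdot l (s n)| <= `|M1| + `|M2|.
  have a1 := ler_norm M1; have a2 := ler_norm M2.
  have := normr_ge0 M1; have := normr_ge0 M2.
  by rewrite ler_norml; lra.
have h4 := lb n; have h5 : (4 / 3) ^+ n <= q ^+ n * rnorm (s n).
  by rewrite exprMn mulrC ler_wpM2l ?exprn_ge0 ?ltW.
by move: (q ^+ n) ((4 / 3) ^+ n) hn h4 h5 => z w; lra.
Qed.

End RealNorm.

(** * Complete contractivity of *-representations *)

Section BoundedOperatorTheory.
Variables (C : numClosedFieldType) (X Y : normedModType C).
Implicit Types (T : bop X Y) (x y : X) (c : C).

Lemma bopP T c x y : T (c *: x + y) = c *: T x + T y.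
Proof. by have /asboolP[lT _] := valP T; exact: lT. Qed.

Lemma bop0 T : T 0 = 0.
Proof. by have := bopP T (-1) 0 0; rewrite scaler0 addr0 scaleN1r addNr. Qed.

Lemma bopZ T c x : T (c *: x) = c *: T x.
Proof. by rewrite -[c *: x]addr0 bopP bop0 addr0. Qed.

Lemma bopD T x y : T (x + y) = T x + T y.
Proof. by have := bopP T 1 x y; rewrite !scale1r. Qed.

Lemma bop_sum T (I : finType) (F : I -> X) : T (\sum_i F i) = \sum_i T (F i).
Proof. exact: (big_morph T (bopD T) (bop0 T)). Qed.

End BoundedOperatorTheory.

Section CStarTheory.
Variable R : realType.
Local Notation C := (R[i]).
Local Open Scope complex_scope.
Variable A : cstarType C.
Implicit Types a b c h x y z : A.

Lemma cmulDl x y z : cmul (x + y) z = cmul x z + cmul y z.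
Proof. by have := cmulPl 1 x y z; rewrite !scale1r. Qed.

Lemma cmulDr x y z : cmul z (x + y) = cmul z x + cmul z y.
Proof. by have := cmulPr 1 x y z; rewrite !scale1r. Qed.

Lemma cmul0l z : cmul 0 z = 0.
Proof. by apply: (addrI (cmul 0 z)); rewrite -cmulDl !addr0. Qed.

Lemma cmulNl x z : cmul (- x) z = - cmul x z.
Proof. by apply/eqP; rewrite -addr_eq0 -cmulDl addNr cmul0l. Qed.

Lemma cmulNr x z : cmul z (- x) = - cmul z x.
Proof.
have c0 : cmul z 0 = 0.
  by apply: (addrI (cmul z 0)); rewrite -cmulDr !addr0.
by apply/eqP; rewrite -addr_eq0 -cmulDr addNr c0.
Qed.

Lemma cmulBl x y z : cmul (x - y) z = cmul x z - cmul y z.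
Proof. by rewrite cmulDl cmulNl. Qed.

Lemma cmulBr x y z : cmul z (x - y) = cmul z x - cmul z y.
Proof. by rewrite cmulDr cmulNr. Qed.

Lemma starD x y : star (x + y) = star x + star y.
Proof. by have := starP 1 x y; rewrite rmorph1 !scale1r. Qed.

Lemma star0 : star (0 : A) = 0.
Proof. by apply: (addrI (star 0)); rewrite -starD !addr0. Qed.

Lemma starN x : star (- x) = - star x.
Proof. by apply/eqP; rewrite -addr_eq0 -starD addNr star0. Qed.

Lemma starB x y : star (x - y) = star x - star y.
Proof. by rewrite starD starN. Qed.

Lemma starZR (t : R) x : star (t%:C *: x) = t%:C *: star x.
Proof.
have tJ : Num.conj t%:C = t%:C by exact: conjc_real.
by rewrite -[_ *: x]addr0 starP star0 addr0 tJ.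
Qed.

Lemma star_sum (I : finType) (F : I -> A) : star (\sum_i F i) = \sum_i star (F i).
Proof. exact: (big_morph _ starD star0). Qed.

Lemma star1 : star (cone : A) = cone.
Proof. by have := starM cone (star (cone : A)); rewrite cmul1x !starK cmul1x. Qed.

Lemma rnorm_cmul x y : rnorm (cmul x y) <= rnorm x * rnorm y.
Proof. by rewrite -lecR rmorphM/= -!rnormE cnormM. Qed.

Lemma rnorm_star_mul x : rnorm (cmul (star x) x) = rnorm x ^+ 2.
Proof. by apply: complexI; rewrite rmorphXn/= -!rnormE cnorm_star. Qed.

Lemma rnorm_star x : rnorm (star x) = rnorm x.
Proof.
have le y : rnorm y <= rnorm (star y).
  have := rnorm_ge0 y; rewrite le_eqVlt => /orP[/eqP<-|y0].
    exact: rnorm_ge0.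
  by rewrite -(ler_pM2r y0) -expr2 -rnorm_star_mul rnorm_cmul.
by apply: le_anti; rewrite le -{2}(starK x) le.
Qed.

(* The square root is [1 - c], where [c] is the fixed point of the contraction
   [c |-> (h + c^2) / 2] of the ball of radius [|h|]. *)
Lemma sa_sqrt_one_sub h : star h = h -> rnorm h < 1 ->
  exists b, star b = b /\ cmul b b = cone - h.
Proof.
move=> hs h1; set q := rnorm h in h1.
have q0 : 0 <= q := rnorm_ge0 h.
have q01 : 0 <= q < 1 by rewrite q0.
pose half : R := 2^-1.
pose g c := half%:C *: (h + cmul c c).
pose u n := iter n g 0.
have rhalf x : rnorm (half%:C *: x) = rnorm x / 2.
  by rewrite rnormZR ger0_norm ?invr_ge0// mulrC.
(* The ball of radius [q] is preserved because [(q + q^2) / 2 <= q]. *)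
have uq n : rnorm (u n) <= q.
  elim: n => [|n IH]; first by rewrite rnorm0.
  rewrite /= rhalf; have := rnormD h (cmul (u n) (u n)).
  have := rnorm_cmul (u n) (u n); have := rnorm_ge0 (u n); rewrite -/q; nra.
(* [x^2 - y^2 = x (x - y) + (x - y) y] holds without commutativity. *)
have gB x y : g x - g y = half%:C *: (cmul x (x - y) + cmul (x - y) y).
  by rewrite -scalerBr cmulBl cmulBr subrKA opprD addrACA subrr add0r.
have gle x y K : rnorm x + rnorm y <= K ->
    rnorm (g x - g y) <= K / 2 * rnorm (x - y).
  move=> xy; rewrite gB rhalf; have := rnormD (cmul x (x - y)) (cmul (x - y) y).
  have := rnorm_cmul x (x - y); have := rnorm_cmul (x - y) y.
  by have := rnorm_ge0 (x - y); nra.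
have step n : rnorm (u n.+1 - u n) <= q * q ^+ n.
  elim: n => [|n IH]; first by rewrite subr0 mulr1.
  rewrite exprS -[u n.+2]/(g (u n.+1)) -[u n.+1 in X in _ - X]/(g (u n)).
  apply: (le_trans (gle _ _ (q + q) (lerD (uq _) (uq _)))).
  by rewrite (_ : (q + q) / 2 = q) ?ler_wpM2l//; field.
have [c hc] := geometric_cvg q01 step.
set K := q / (1 - q) in hc.
have eq_lim x (M : R) : (forall n, rnorm x <= M * q ^+ n) -> x = 0.
  move=> hx; apply: rnorm0_eq0; apply: le_anti.
  by rewrite rnorm_ge0 (le0_geometric q01 hx).
have us n : star (u n) = u n.
  by elim: n => [|n IH]; rewrite ?star0//= starZR starD hs starM IH.
have cs : star c = c.
  apply/subr0_eq; apply: (eq_lim _ (K + K)) => n.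
  rewrite -[star c - c](subrKA (u n)) mulrDl (le_trans (rnormD _ _))// lerD//.
    by rewrite -[X in _ - X]us -starB rnorm_star.
  by rewrite -opprB rnormN.
(* The limit is only placed in a ball of radius [K + q]. The Lipschitz constant of [g] available
   there may exceed 1, which still allows passing to the limit in [u n.+1 = g (u n)]. *)
have gc : g c = c.
  have cK : rnorm c <= K + q.
    have := hc 0%N; rewrite expr0 mulr1 subr0 => /le_trans; apply.
    by rewrite lerDl.
  apply/subr0_eq; apply: (eq_lim _ ((K + q + q) / 2 * K + K)) => n.
  rewrite -[g c - c](subrKA (g (u n))) mulrDl (le_trans (rnormD _ _))// lerD//.
    apply: (le_trans (gle _ _ (K + q + q) (lerD cK (uq n)))).
    rewrite -[leRHS]mulrA ler_wpM2l ?hc// divr_ge0// !addr_ge0//.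
    by rewrite divr_ge0// subr_ge0 ltW.
  rewrite -opprB rnormN; apply: (le_trans (hc n.+1)).
  rewrite exprS ler_wpM2l//; first by rewrite divr_ge0// subr_ge0 ltW.
  by rewrite ler_piMl ?exprn_ge0// ltW.
exists (cone - c); split; first by rewrite starB star1 cs.
(* Twice the fixed point equation; it turns [(1 - c)^2 = 1 - 2 c + c^2] into [1 - h]. *)
have cE : c + c = h + cmul c c.
  rewrite -[in LHS]gc /g -scalerDl.
  have -> : half%:C + half%:C = 1 by rewrite -rmorphD/= /half -[2^-1]mul1r -splitr.
  by rewrite scale1r.
rewrite -(addrK (cmul c c) h) -cE.
by rewrite cmulBl cmul1x cmulBr cmulx1 !opprB opprD !addrA (addrAC cone).
Qed.

Section Representation.
Variables (X : hilbertType C) (sigma : A -> bop X X).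
Hypothesis rep : star_rep sigma.

Lemma rep_comb (c : C) a b (x : X) : sigma (c *: a + b) x = c *: sigma a x + sigma b x.
Proof. by case: rep => -> _ _ _. Qed.

Lemma repM a b (x : X) : sigma (cmul a b) x = sigma a (sigma b x).
Proof. by case: rep. Qed.

Lemma rep1 (x : X) : sigma cone x = x.
Proof. by case: rep. Qed.

Lemma rep_star a (x y : X) : rdot (sigma (star a) x) y = rdot x (sigma a y).
Proof. by case: rep => _ _ _ h; rewrite /rdot h. Qed.

Lemma rep0 (x : X) : sigma 0 x = 0.
Proof. by have := rep_comb (-1) 0 0 x; rewrite scaler0 addr0 scaleN1r addNr. Qed.

Lemma repZ (c : C) a (x : X) : sigma (c *: a) x = c *: sigma a x.
Proof. by rewrite -[c *: a]addr0 rep_comb rep0 addr0. Qed.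

Lemma repD a b (x : X) : sigma (a + b) x = sigma a x + sigma b x.
Proof. by have := rep_comb 1 a b x; rewrite !scale1r. Qed.

Lemma repB a b (x : X) : sigma (a - b) x = sigma a x - sigma b x.
Proof. by rewrite addrC -scaleN1r rep_comb scaleN1r addrC. Qed.

Lemma rep_sum (I : finType) (F : I -> A) (x : X) :
  sigma (\sum_i F i) x = \sum_i sigma (F i) x.
Proof.
by apply: (big_morph (fun a => sigma a x)) => [a b|]; [exact: repD|exact: rep0].
Qed.

(** With [1 - h = b^2] and [b] self-adjoint, [|x|^2 - <sigma(h) x, x> = |sigma(b) x|^2 >= 0]. *)
Lemma rep_sa_le h (x : X) : star h = h -> rnorm h < 1 ->
  rdot (sigma h x) x <= rnorm x ^+ 2.
Proof.
move=> hs h1; have [b [bs bb]] := sa_sqrt_one_sub hs h1.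
have := rdotxx (sigma b x); rewrite -{1}bs rep_star -repM bb repB rep1 rdotBr.
by rewrite rdotxx rdotC => E; have := sqr_ge0 (rnorm (sigma b x)); lra.
Qed.

(** Contractivity is automatic: [rep_sa_le] at [a^* a / t] with [t > |a|^2] gives
    [|sigma(a) x|^2 <= t |x|^2], and [t] decreases to [|a|^2]. *)
Lemma rep_contract a (x : X) : rnorm (sigma a x) <= rnorm a * rnorm x.
Proof.
rewrite -(ler_pXn2r (ltn0Sn 1)) ?nnegrE ?mulr_ge0 ?rnorm_ge0// exprMn.
have le t : rnorm a ^+ 2 < t -> rnorm (sigma a x) ^+ 2 <= t * rnorm x ^+ 2.
  move=> at_; have t0 : 0 < t := le_lt_trans (sqr_ge0 _) at_.
  rewrite -ler_pdivrMl//.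
  have := @rep_sa_le (t^-1%:C *: cmul (star a) a) x.
  rewrite starZR starM starK => /(_ erefl).
  have tN : `|t^-1| = t^-1 by rewrite ger0_norm// invr_ge0 ltW.
  rewrite rnormZR rnorm_star_mul tN mulrC.
  by rewrite ltr_pdivrMr// mul1r repZ repM rdotZl rep_star rdotxx => /(_ at_).
have := sqr_ge0 (rnorm x); rewrite le_eqVlt => /orP[/eqP x0|x0].
  by have := le (rnorm a ^+ 2 + 1) (ltr_pwDr ltr01 (lexx _)); rewrite -x0 !mulr0.
rewrite -ler_pdivrMr//; apply/ler_addgt0Pl => e e0; rewrite ler_pdivrMr//.
by apply: le; rewrite ltrDr.
Qed.

End Representation.
End CStarTheory.

(** * Matrices of operators and amplified representations *)

Section MatrixBounds.
Variable R : realType.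
Local Notation C := (R[i]).
Local Open Scope complex_scope.

Definition mxapp (X Y : normedModType C) (I J : finType)
  (T : I -> J -> X -> Y) (x : J -> X) (i : I) : Y := \sum_j T i j (x j).

(** The form, free of extended reals, in which bounds on [mxopnorm] are handled. As the index types
    are arbitrary, an amplification is just a matrix indexed by pairs. *)
Definition mxbounded (X Y : normedModType C) (I J : finType)
    (T : I -> J -> X -> Y) (c : R) : Prop :=
  forall x, l2norm (mxapp T x) <= c * l2norm x.

Lemma mxopnorm_leP (X Y : normedModType C) (I J : finType)
    (T : I -> J -> X -> Y) (c : R) : 0 <= c ->
    (forall i j a x, T i j (a *: x) = a *: T i j x) ->
  (mxopnorm T <= c%:E)%E <-> mxbounded T c.
Proof.
move=> c0 TZ; split=> [h x|h]; last first.
  apply: ge_ereal_sup => _ [x /= x1 <-]; rewrite !lee_fin in x1 *.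
  by apply: (le_trans (h x)); rewrite ler_piMr.
have appZ a y i : mxapp T (fun j => a *: y j) i = a *: mxapp T y i.
  by rewrite scaler_sumr; apply: eq_bigr => j _; rewrite TZ.
have := l2norm_ge0 x; rewrite le_eqVlt => /orP[/eqP/esym x0|x0].
  suff -> : mxapp T x = (fun=> 0) by rewrite l2norm_cst0 mulr_ge0 ?x0.
  apply/funext => i; rewrite /mxapp big1// => j _.
  by rewrite (l2norm_eq0 j x0) -[0 in LHS](scale0r 0) TZ scale0r.
rewrite -ler_pdivrMr// -lee_fin; apply: le_trans h; apply: ereal_sup_ubound.
have vE (Z : normedModType C) (K : finType) (z : K -> Z) :
    l2norm (fun k => (l2norm x)^-1%:C *: z k) = l2norm z / l2norm x.
  by rewrite l2normZ rnormR ger0_norm ?invr_ge0 ?l2norm_ge0// mulrC.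
exists (fun j => (l2norm x)^-1%:C *: x j) => /=.
  by rewrite vE divff ?gt_eqF.
congr EFin; rewrite -vE; congr l2norm; apply/funext => i; exact: appZ.
Qed.

(** [|S y|^2 = <y, T S y> <= c |y| |S y|], and [|S y|] cancels. *)
Lemma mxbounded_adjoint (X Y : hilbertType C) (I J : finType)
    (T : I -> J -> X -> Y) (S : J -> I -> Y -> X) (c : R) : 0 <= c ->
    (forall x y, fdot (mxapp S y) x = fdot y (mxapp T x)) ->
  mxbounded T c -> mxbounded S c.
Proof.
move=> c0 TS hT y; set s := l2norm (mxapp S y).
have : s ^+ 2 <= c * l2norm y * s.
  rewrite -fdotxx TS (le_trans (fdot_le _ _))//.
  by rewrite -mulrA [leRHS]mulrCA ler_wpM2l ?l2norm_ge0// hT.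
have : 0 <= s by exact: l2norm_ge0.
rewrite le_eqVlt => /orP[/eqP<- _|s0]; first by rewrite mulr_ge0 ?l2norm_ge0.
by rewrite expr2 ler_pM2r.
Qed.

Section MatrixRepresentation.
Variables (A : cstarType C).

Definition repmx (X : hilbertType C) (sigma : A -> bop X X) (I J : finType)
  (P : I -> J -> A) : I -> J -> X -> X := fun i j => sigma (P i j).

Definition fstar (I J : finType) (P : I -> J -> A) (j : J) (i : I) : A :=
  star (P i j).

Definition fmul (I J K : finType) (P : I -> J -> A) (Q : J -> K -> A)
  (i : I) (k : K) : A := \sum_j cmul (P i j) (Q j k).

Lemma fstarK (I J : finType) (P : I -> J -> A) : fstar (fstar P) = P.
Proof. by apply/funext => i; apply/funext => j; rewrite /fstar starK. Qed.

Lemma fstarM (I J K : finType) (P : I -> J -> A) (Q : J -> K -> A) :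
  fstar (fmul P Q) = fmul (fstar Q) (fstar P).
Proof.
apply/funext => k; apply/funext => i; rewrite /fstar /fmul star_sum.
by apply: eq_bigr => j _; rewrite starM.
Qed.

Section OneRepresentation.
Variables (X : hilbertType C) (sigma : A -> bop X X).
Hypothesis rep : star_rep sigma.

Lemma repmx_star (I J : finType) (P : I -> J -> A) x y :
  fdot (mxapp (repmx sigma (fstar P)) y) x = fdot y (mxapp (repmx sigma P) x).
Proof.
rewrite /fdot /mxapp; under eq_bigr do rewrite rdot_suml.
rewrite exchange_big; apply: eq_bigr => i _; rewrite rdot_sumr.
by apply: eq_bigr => j _; rewrite /repmx /fstar (rep_star rep).
Qed.

Lemma repmxM (I J K : finType) (P : I -> J -> A) (Q : J -> K -> A) x :
  mxapp (repmx sigma P) (mxapp (repmx sigma Q) x) =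
  mxapp (repmx sigma (fmul P Q)) x.
Proof.
apply/funext => i; rewrite /mxapp /repmx; under eq_bigr do rewrite bop_sum.
rewrite exchange_big; apply: eq_bigr => k _; rewrite (rep_sum rep).
by apply: eq_bigr => j _; rewrite (repM rep).
Qed.

Lemma repmx_bounded_star (I J : finType) (P : I -> J -> A) c : 0 <= c ->
  mxbounded (repmx sigma P) c -> mxbounded (repmx sigma (fstar P)) c.
Proof. by move=> c0; apply: mxbounded_adjoint => // x y; exact: repmx_star. Qed.

Lemma repmx_boundedM (I J K : finType) (P : I -> J -> A) (Q : J -> K -> A) c d :
  0 <= c -> mxbounded (repmx sigma P) c -> mxbounded (repmx sigma Q) d ->
  mxbounded (repmx sigma (fmul P Q)) (c * d).
Proof.
move=> c0 hP hQ x; rewrite -repmxM (le_trans (hP _))// -mulrA.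
by rewrite ler_wpM2l.
Qed.

(** Cauchy-Schwarz for [|P x|^2 = <x, P^* P x>]; it trades a matrix for the self-adjoint [P^* P]. *)
Lemma sqr_l2norm_repmx (I J : finType) (P : I -> J -> A) x :
  l2norm (mxapp (repmx sigma P) x) ^+ 2 <=
  l2norm x * l2norm (mxapp (repmx sigma (fmul (fstar P) P)) x).
Proof.
by rewrite -fdotxx -repmx_star repmxM fdotC fdot_le.
Qed.

End OneRepresentation.

Section CompleteContraction.
Variables (E : hilbertType C) (iota : A -> bop E E).
Hypothesis iota_rep : star_rep iota.
Hypothesis iota_isom : forall a : A,
  opmx_norm (\matrix_(i < 1, j < 1) iota a) = (rnorm a)%:E.
Variables (X : hilbertType C) (sigma : A -> bop X X).
Hypothesis rep : star_rep sigma.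

(** A single entry is seen by vectors supported at [j] and read off at coordinate [i]; isometry of
    [iota] turns its operator norm into the norm of [A]. *)
Lemma rnorm_entry_le (I J : finType) (P : I -> J -> A) c i j : 0 <= c ->
  mxbounded (repmx iota P) c -> rnorm (P i j) <= c.
Proof.
move=> c0 hP; rewrite -lee_fin -iota_isom.
apply/mxopnorm_leP => // [k l a x|x]; first by rewrite mxE bopZ.
pose x' j' := if j' == j then x ord0 else 0.
have xE : l2norm x' = l2norm x.
  rewrite /l2norm (bigD1 j)//= /x' eqxx big1 ?addr0 ?big_ord1// => k /negbTE->.
  by rewrite rnorm0 expr0n.
rewrite -xE; apply: le_trans (hP x').
rewrite (_ : l2norm _ = rnorm (mxapp (repmx iota P) x' i)) ?rnorm_le_l2norm//.
rewrite /l2norm big_ord1 sqrtr_sqr ger0_norm ?rnorm_ge0// /mxapp big_ord1 mxE.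
rewrite (bigD1 j)//= /repmx /x' eqxx big1 ?addr0// => k /negbTE->.
by rewrite bop0.
Qed.

Lemma rep_crude_bound (I : finType) (h : I -> I -> A) c x : 0 <= c ->
  mxbounded (repmx iota h) c ->
  l2norm (mxapp (repmx sigma h) x) <= #|I|%:R ^+ 2 * (c * l2norm x).
Proof.
move=> c0 hh; apply: (le_trans (l2norm_le_sum _)).
rewrite expr2 -mulrA mulr_natl -sumr_const; apply: ler_sum => i _.
apply: (le_trans (rnorm_sum _)).
rewrite mulr_natl -sumr_const; apply: ler_sum => j _.
apply: (le_trans (rep_contract rep _ _)).
by apply: ler_pM; rewrite ?rnorm_ge0 ?rnorm_le_l2norm// (rnorm_entry_le _ _ c0 hh).
Qed.

(* Scalar contractivity only yields a bound with a constant depending on the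
   size; applying it to the powers [h^(2^k)] removes the constant. *)
Lemma rep_sa_contract (I : finType) (h : I -> I -> A) c : 0 <= c ->
  fstar h = h -> mxbounded (repmx iota h) c -> mxbounded (repmx sigma h) c.
Proof.
move=> c0 hs hh x; apply: (@le_pow2_root _ _ _ (#|I|%:R ^+ 2)).
  by rewrite mulr_ge0 ?l2norm_ge0.
(* The induction ranges over all [h] and [c]: since [|h x|^2 <= |x| |h^2 x|], the exponent [2^(k+1)]
   for [h] reduces to [2^k] for [h^2], which [iota] bounds by [c^2]. *)
move=> k; elim: k h c c0 hs hh => [|k IH] h c c0 hs hh.
  by rewrite expn0 !expr1 rep_crude_bound.
have h2 : mxbounded (repmx iota (fmul h h)) (c * c) by exact: repmx_boundedM.
have := IH (fmul h h) (c * c) (mulr_ge0 c0 c0) _ h2; rewrite fstarM hs.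
move=> /(_ erefl) le2.
have := sqr_l2norm_repmx rep h x; rewrite hs => le1.
rewrite expnS !exprM.
have : (l2norm (mxapp (repmx sigma h) x) ^+ 2) ^+ (2 ^ k) <=
       (l2norm x * l2norm (mxapp (repmx sigma (fmul h h)) x)) ^+ (2 ^ k).
  by rewrite lerXn2r// nnegrE ?sqr_ge0// mulr_ge0 ?l2norm_ge0.
move=> /le_trans; apply; rewrite exprMn.
apply: (le_trans (ler_wpM2l (exprn_ge0 _ (l2norm_ge0 x)) le2)).
rewrite mulrCA -exprMn le_eqVlt; apply/orP; left; apply/eqP.
by congr (_ * _ ^+ _); ring.
Qed.

(** A rectangular [P] reduces to the self-adjoint [P^* P], which [iota] bounds by [c^2]: then
    [|P x|^2 <= |x| |P^* P x| <= c^2 |x|^2]. *)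
Lemma rep_complete_contract (I J : finType) (P : I -> J -> A) c : 0 <= c ->
  mxbounded (repmx iota P) c -> mxbounded (repmx sigma P) c.
Proof.
move=> c0 hP x.
have cc : mxbounded (repmx sigma (fmul (fstar P) P)) (c * c).
  apply: rep_sa_contract; first exact: mulr_ge0.
    by rewrite fstarM fstarK.
  by apply: repmx_boundedM => //; exact: repmx_bounded_star.
rewrite -(ler_pXn2r (ltn0Sn 1)) ?nnegrE ?mulr_ge0 ?l2norm_ge0//.
apply: (le_trans (sqr_l2norm_repmx rep P x)).
apply: (le_trans (ler_wpM2l (l2norm_ge0 x) (cc x))).
by rewrite le_eqVlt; apply/orP; left; apply/eqP; ring.
Qed.

End CompleteContraction.
End MatrixRepresentation.
End MatrixBounds.

(** * Factorizations of kernels *)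

Section OperatorMatrices.
Variable R : realType.
Local Notation C := (R[i]).
Local Open Scope complex_scope.

Definition opm (X Y : normedModType C) n m (T : 'M[bop X Y]_(n, m)) :
  'I_n -> 'I_m -> X -> Y := fun i j => T i j.

Lemma applymxE (X Y : normedModType C) n m (T : 'M[bop X Y]_(n, m))
    (x : 'cV[X]_m) i : (T *v x) i 0 = mxapp (opm T) (fun j => x j 0) i.
Proof. by rewrite mxE. Qed.

(** Column norms test an amplification on scalar vectors; this carries their coefficients through
    [T] onto the vectors it acts on. *)
Lemma mxapp_comb (X Y : normedModType C) n m (T : 'M[bop X Y]_(n, m))
    (J : finType) (c : J -> C) (x : J -> 'I_m -> X) i :
  \sum_j c j *: mxapp (opm T) (x j) i =
  mxapp (opm T) (fun l => \sum_j c j *: x j l) i.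
Proof.
rewrite /mxapp; under eq_bigr do rewrite scaler_sumr.
rewrite exchange_big; apply: eq_bigr => l _; rewrite /opm bop_sum.
by apply: eq_bigr => j _; rewrite bopZ.
Qed.

Lemma Re_cdot (X : hilbertType C) n (x y : 'cV[X]_n) :
  complex.Re (cdot x y) = fdot (fun i => x i 0) (fun i => y i 0).
Proof.
by rewrite /cdot (big_morph (@complex.Re R) (id1 := 0) (op1 := +%R))// => -[? ?] [].
Qed.

Lemma opnorm_le (E F : Type) (nE : E -> \bar R) (nF : F -> \bar R)
    (phi : E -> F) (M : \bar R) :
  (forall x, (nE x <= 1)%E -> (nF (phi x) <= M)%E) -> (opnorm nE nF phi <= M)%E.
Proof. by move=> h; apply: ge_ereal_sup => _ [x /= x1 <-]; exact: h. Qed.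

Lemma mxopnorm_bounded (X Y : normedModType C) (I J : finType)
    (T : I -> J -> X -> Y) (M : R) :
    (forall i j a x, T i j (a *: x) = a *: T i j x) ->
  (mxopnorm T <= M%:E)%E -> mxbounded T `|M|.
Proof.
move=> TZ TM; apply/mxopnorm_leP => //.
by apply: le_trans TM _; rewrite lee_fin ler_norm.
Qed.

Lemma mxbounded_fdot (X Y : hilbertType C) (I J : finType)
    (T : I -> J -> X -> Y) (c : R) : 0 <= c ->
    (forall x y, fdot (mxapp T x) y <= c * l2norm x * l2norm y) ->
  mxbounded T c.
Proof.
move=> c0 hT x; have := hT x (mxapp T x); rewrite fdotxx expr2.
have : 0 <= l2norm (mxapp T x) by exact: l2norm_ge0.
rewrite le_eqVlt => /orP[/eqP<- _|s0]; first by rewrite mulr_ge0 ?l2norm_ge0.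
by rewrite ler_pM2r.
Qed.

Section Reindex.
Variables (X Y : normedModType C) (I J I' J' : finType).
Variables (T : I -> J -> X -> Y) (f : I' -> I) (g : J' -> J).
Hypotheses (bf : bijective f) (bg : bijective g).

Lemma mxapp_reindex x :
  mxapp T x \o f = mxapp (fun i j => T (f i) (g j)) (x \o g).
Proof.
by apply/funext => i; rewrite /= /mxapp (reindex g)//; exact: onW_bij.
Qed.

(** Relabelling serves to identify an amplification of size 1, indexed by ['I_1 * 'I_n], with the
    matrix indexed by ['I_n]. *)
Lemma mxbounded_reindex c :
  mxbounded (fun i j => T (f i) (g j)) c -> mxbounded T c.
Proof.
move=> hT x; rewrite -(l2norm_reindex _ bf) mxapp_reindex (le_trans (hT _))//.
by rewrite l2norm_reindex.
Qed.

Lemma mxopnorm_reindex_le :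
  (mxopnorm T <= mxopnorm (fun i j => T (f i) (g j)))%E.
Proof.
apply: opnorm_le => x x1; apply: ereal_sup_ubound; exists (x \o g) => /=.
  by rewrite l2norm_reindex.
by rewrite -[X in l2norm X]mxapp_reindex l2norm_reindex.
Qed.

End Reindex.

(** Squared norms of blocks add up, so applying [g] to each block costs no factor depending on
    [I]. *)
Lemma l2norm_amplify (X Y : normedModType C) (I J K : finType)
    (g : (J -> X) -> K -> Y) (d : R) (x : I * J -> X) : 0 <= d ->
    (forall z, l2norm (g z) <= d * l2norm z) ->
  l2norm (fun ik : I * K => g (fun j => x (ik.1, j)) ik.2) <= d * l2norm x.
Proof.
move=> d0 hg.
rewrite -(ler_pXn2r (ltn0Sn 1)) ?nnegrE ?mulr_ge0 ?l2norm_ge0//.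
rewrite exprMn !l2norm_pair mulr_sumr; apply: ler_sum => i _ /=.
by rewrite -exprMn lerXn2r// ?nnegrE ?mulr_ge0 ?l2norm_ge0.
Qed.

(** A bound in terms of the entries is enough where [P] is fixed, as in [P]-local boundedness. *)
Lemma repmx_crude (A : cstarType C) (X : hilbertType C) (sigma : A -> bop X X)
    (rep : star_rep sigma) (I J : finType) (P : I -> J -> A) :
  mxbounded (repmx sigma P) (\sum_i \sum_j rnorm (P i j)).
Proof.
move=> x; apply: (le_trans (l2norm_le_sum _)); rewrite mulr_suml.
apply: ler_sum => i _; apply: (le_trans (rnorm_sum _)); rewrite mulr_suml.
apply: ler_sum => j _; apply: (le_trans (rep_contract rep _ _)).
by rewrite ler_wpM2l ?rnorm_ge0 ?rnorm_le_l2norm.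
Qed.

End OperatorMatrices.

(** * Bounds on a kernel and its factor *)

Section Kernels.
Variable R : realType.
Local Notation C := (R[i]).
Local Open Scope complex_scope.
Variables (V : completeNormedModType C) (Omega : forall n, set 'M[V]_n).
Variables (A : cstarType C) (Y : hilbertType C) (E : hilbertType C).
Variables (iota : A -> bop E E).
Hypothesis iota_rep : star_rep iota.
Hypothesis iota_isom : forall a : A,
  opmx_norm (\matrix_(i < 1, j < 1) iota a) = (rnorm a)%:E.
Variable K : kernel V A Y.

Lemma cone_mx_rep (X : hilbertType C) (sigma : A -> bop X X) n x :
  star_rep sigma -> mxapp (repmx sigma (cone_mx A n)) x = x.
Proof.
move=> rep; apply/funext => i; rewrite /mxapp (bigD1 i)//= /repmx mxE eqxx.
rewrite (rep1 rep) big1 ?addr0// => j /negbTE ji.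
by rewrite mxE eq_sym ji (rep0 rep).
Qed.

Section Factorization.
Variables (X : hilbertType C) (sigma : A -> bop X X).
Hypothesis rep : star_rep sigma.

(* [h W] plays the role of the adjoint of the factor [H W] of a Kolmogorov
   decomposition. *)
Variable h : forall m, 'M[V]_m -> ('I_m -> Y) -> 'I_m -> X.
Hypothesis factor : forall n m (Z : 'M[V]_n) (W : 'M[V]_m) (P : 'M[A]_(n, m))
    (y : 'I_m -> Y) (z : 'I_n -> Y), Omega Z -> Omega W ->
  fdot (mxapp (opm (K Z W P)) y) z =
  fdot (mxapp (repmx sigma P) (h W y)) (h Z z).

(** At [P = 1] the factorization reads [|h(Z) y|^2 = <K(Z,Z)(1) y, y>]. *)
Lemma factor_bound n (Z : 'M[V]_n) M y : Omega Z -> 0 <= M ->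
    mxbounded (opm (K Z Z (cone_mx A n))) M ->
  l2norm (h Z y) <= Num.sqrt M * l2norm y.
Proof.
move=> OZ M0 hM.
rewrite -(ler_pXn2r (ltn0Sn 1)) ?nnegrE ?mulr_ge0 ?l2norm_ge0 ?sqrtr_ge0//.
rewrite exprMn (sqr_sqrtr M0) -fdotxx -{1}(cone_mx_rep (h Z y) rep) -factor//.
rewrite (le_trans (fdot_le _ _))// expr2 mulrA ler_wpM2r ?l2norm_ge0//.
Qed.

Lemma kernel_bound n m (Z : 'M[V]_n) (W : 'M[V]_m) (P : 'M[A]_(n, m))
    (c d d' : R) :
    Omega Z -> Omega W -> 0 <= c -> 0 <= d -> 0 <= d' ->
    (forall y, l2norm (h Z y) <= d * l2norm y) ->
    (forall y, l2norm (h W y) <= d' * l2norm y) ->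
  mxbounded (repmx sigma P) c -> mxbounded (opm (K Z W P)) (c * d' * d).
Proof.
move=> OZ OW c0 d0 d'0 hZ hW hP.
apply: mxbounded_fdot => [|y z]; first by rewrite !mulr_ge0.
rewrite factor// (le_trans (fdot_le _ _))//.
rewrite [leRHS](_ : _ = c * (d' * l2norm y) * (d * l2norm z)); last by ring.
by rewrite ler_pM ?l2norm_ge0// (le_trans (hP _))// ler_wpM2l.
Qed.

(** Amplifying all three factors, the outer ones keep the bounds [d] and [d'] by [l2norm_amplify],
    and the middle one is contractive by [rep_complete_contract]. *)
Lemma kernel_cb_bound n m (Z : 'M[V]_n) (W : 'M[V]_m) (d d' : R) :
    Omega Z -> Omega W -> 0 <= d -> 0 <= d' ->
    (forall y, l2norm (h Z y) <= d * l2norm y) ->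
    (forall y, l2norm (h W y) <= d' * l2norm y) ->
  (kernel_cbnorm iota (K Z W) <= (d' * d)%:E)%E.
Proof.
move=> OZ OW d0 d'0 hZ hW; apply: ge_ereal_sup => _ [N _ <-].
apply: opnorm_le => B B1.
have hB : mxbounded (repmx sigma
    (fun (i : 'I_N * 'I_n) (j : 'I_N * 'I_m) => B i.1 j.1 i.2 j.2)) 1.
  apply: (rep_complete_contract iota_rep iota_isom rep ler01).
  have := (mxopnorm_leP ler01 _).1 B1.
  have -> : (fun (i : 'I_N * 'I_n) (j : 'I_N * 'I_m) =>
     map_mx (map_mx iota) B i.1 j.1 i.2 j.2 : E -> E) = repmx iota
    (fun (i : 'I_N * 'I_n) (j : 'I_N * 'I_m) => B i.1 j.1 i.2 j.2).
    by apply/funext => i; apply/funext => j; rewrite !mxE.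
  by apply => i j a x; rewrite bopZ.
apply/mxopnorm_leP; [by rewrite mulr_ge0|by move=> *; rewrite bopZ|].
apply: mxbounded_fdot => [|y z]; first by rewrite mulr_ge0.
pose hy (j : 'I_N * 'I_m) := h W (fun k => y (j.1, k)) j.2.
pose hz (i : 'I_N * 'I_n) := h Z (fun k => z (i.1, k)) i.2.
have ly : l2norm hy <= d' * l2norm y by exact: l2norm_amplify.
have lz : l2norm hz <= d * l2norm z by exact: l2norm_amplify.
rewrite (_ : fdot _ _ = fdot (mxapp (repmx sigma
    (fun (i : 'I_N * 'I_n) (j : 'I_N * 'I_m) => B i.1 j.1 i.2 j.2)) hy) hz).
  apply: (le_trans (fdot_le _ _)).
  rewrite [leRHS](_ : _ = d' * l2norm y * (d * l2norm z)); last by ring.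
  by rewrite ler_pM ?l2norm_ge0// (le_trans (hB _))// mul1r.
(* The factorization is applied to each block [B a b]; the rest regroups sums over pairs of
   indices. *)
transitivity (\sum_a \sum_b fdot (mxapp (opm (K Z W (B a b)))
    (fun k => y (b, k))) (fun k => z (a, k))); last first.
  transitivity (\sum_a \sum_i rdot (\sum_b \sum_j
      sigma (B a b i j) (hy (b, j))) (hz (a, i))).
    apply: eq_bigr => a _; under [RHS]eq_bigr do rewrite rdot_suml.
    rewrite [RHS]exchange_big/=; apply: eq_bigr => b _; exact: factor.
  rewrite pair_bigA/=; apply: eq_bigr => -[a i] _ /=.
  by rewrite /mxapp pair_bigA.
rewrite /fdot [LHS](eq_bigr (fun i => rdot (\sum_b \sum_j
   K Z W (B i.1 b) i.2 j (y (b, j))) (z (i.1, i.2)))); last first.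
  move=> [a i] _ /=; rewrite /mxapp pair_bigA/=; congr rdot.
  by apply: eq_bigr => -[b j] _ /=; rewrite mxE.
rewrite -(pair_bigA _ (fun a i => rdot (\sum_b \sum_j
   K Z W (B a b) i j (y (b, j))) (z (a, i))))/=.
apply: eq_bigr => a _; rewrite exchange_big/=.
by apply: eq_bigr => i _; rewrite rdot_suml.
Qed.

(** If [r] is the norm at 1, then [|h(Z)| <= sqrt r] and the factorization bounds the cb-norm by
    [sqrt r * sqrt r]. The other inequality tests the amplification of size 1 on the unit. The bound
    [M] makes [r] a real number. *)
Lemma opmx_norm_kernel1 n (Z : 'M[V]_n) M : Omega Z ->
    (opmx_norm (K Z Z (cone_mx A n)) <= M%:E)%E ->
  opmx_norm (K Z Z (cone_mx A n)) = kernel_cbnorm iota (K Z Z).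
Proof.
move=> OZ hM; apply: le_anti; apply/andP; split; last first.
  have r0 : (0 <= opmx_norm (K Z Z (cone_mx A n)))%E.
    apply: ereal_sup_ubound; exists (fun=> 0) => /=.
      by rewrite l2norm_cst0 lee_fin.
    transitivity (l2norm (fun _ : 'I_n => 0 : Y))%:E; last by rewrite l2norm_cst0.
    congr (l2norm _)%:E; apply/funext => i.
    by rewrite big1// => j _; rewrite bop0.
  have rfin : opmx_norm (K Z Z (cone_mx A n)) \is a fin_num.
    by rewrite ge0_fin_numE// (le_lt_trans hM) ?ltry.
  have := lexx (opmx_norm (K Z Z (cone_mx A n))).
  rewrite -{2 3}(fineK rfin); set r := fine _ => hr.
  have r0' : 0 <= r by rewrite /r fine_ge0.
  have hb : mxbounded (opm (K Z Z (cone_mx A n))) r.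
    by apply/mxopnorm_leP => // *; rewrite /opm bopZ.
  rewrite -[r]sqr_sqrtr// expr2.
  by apply: kernel_cb_bound => // y; rewrite factor_bound// sqrtr_ge0.
apply: (@le_trans _ _ (opnorm (cstar_mnorms iota (N := 1))
  (@op_mnorms _ Y Y n n 1) (map_mx (K Z Z)))); last first.
  by apply: ereal_sup_ubound; exists 1%N.
apply: (@le_trans _ _ (op_mnorms (map_mx (K Z Z)
  (\matrix_(i < 1, j < 1) cone_mx A n)))); last first.
  apply: ereal_sup_ubound; exists (\matrix_(i < 1, j < 1) cone_mx A n) => //=.
  apply/mxopnorm_leP; [exact: ler01|by move=> *; rewrite bopZ|].
  apply: (@mxbounded_reindex _ _ _ _ _ _ _ _ (pair ord0) (pair ord0)).
  - by exists snd => // -[i j] /=; rewrite (ord1 i).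
  - by exists snd => // -[i j] /=; rewrite (ord1 i).
  move=> x; rewrite mul1r /=.
  rewrite (_ : mxapp _ x = mxapp (repmx iota (cone_mx A n)) x).
    by rewrite cone_mx_rep.
  by apply/funext => i; apply: eq_bigr => j _; rewrite /repmx !mxE.
rewrite /op_mnorms.
have bij k : bijective (snd : 'I_1 * 'I_k -> 'I_k).
  by exists (pair ord0) => // -[i j] /=; rewrite (ord1 i).
apply: (le_trans (mxopnorm_reindex_le _ (bij n) (bij n))).
suff -> : (fun i j : 'I_1 * 'I_n => map_mx (K Z Z)
    (\matrix_(i < 1, j < 1) cone_mx A n) i.1 j.1 i.2 j.2 : Y -> Y) =
  (fun i j => opm (K Z Z (cone_mx A n)) i.2 j.2) by [].
by apply/funext => i; apply/funext => j; rewrite !mxE.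
Qed.

End Factorization.
End Kernels.

(** * The factor of a Kolmogorov decomposition *)

Section KolmogorovFactor.
Variable R : realType.
Local Notation C := (R[i]).
Local Open Scope complex_scope.
Variables (V : completeNormedModType C) (Omega : forall n, set 'M[V]_n).
Variables (A : cstarType C) (Y X : hilbertType C).
Variables (K : kernel V A Y) (sigma : A -> bop X X).
Variable H : forall n, 'M[V]_n -> 'M[bop X Y]_n.
Hypothesis kolmo : is_min_kolmogorov Omega K sigma H.

(** [|H(Z)^* y|^2 = <K(Z,Z)(1) y, y> <= M |y|^2] bounds the adjoint, and [mxbounded_adjoint] returns
    to [H(Z)]. *)
Lemma kolmo_mxbounded n (Z : 'M[V]_n) M : Omega Z -> 0 <= M ->
    mxbounded (opm (K Z Z (cone_mx A n))) M ->
  mxbounded (opm (H Z)) (Num.sqrt M).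
Proof.
move=> OZ M0 hM; have [HZ adj fact] := kolmo_factor kolmo OZ OZ.
have adjR x y : fdot (mxapp (opm (H Z)) x) y = fdot x (mxapp (opm HZ) y).
  have := congr1 (@complex.Re R) (adj (\col_i x i) (\col_i y i)).
  rewrite !Re_cdot; congr (_ = _); apply: eq_bigr => i _; rewrite applymxE !mxE.
    by congr (rdot (mxapp _ _ _) _); apply/funext => j; rewrite mxE.
  by congr (rdot _ (mxapp _ _ _)); apply/funext => j; rewrite mxE.
apply: (mxbounded_adjoint (T := opm HZ)) => [|x y|y]; [exact: sqrtr_ge0|by []|].
rewrite -(ler_pXn2r (ltn0Sn 1)) ?nnegrE ?mulr_ge0 ?l2norm_ge0 ?sqrtr_ge0//.
rewrite exprMn (sqr_sqrtr M0) -fdotxx -adjR.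
have -> : mxapp (opm (H Z)) (mxapp (opm HZ) y) =
          mxapp (opm (K Z Z (cone_mx A n))) y.
  apply/funext => i; have := congr1 (fun w : 'cV_n => w i 0)
    (fact (cone_mx A n) (\col_i y i)).
  rewrite !applymxE => /esym E; rewrite -[LHS]/(mxapp _ _ i).
  transitivity (mxapp (opm (H Z)) (fun j =>
      (map_mx sigma (cone_mx A n) *v (HZ *v \col_i y i)) j 0) i).
    congr mxapp; apply/funext => j; rewrite applymxE.
    rewrite (_ : opm _ = repmx sigma (cone_mx A n)).
      rewrite (cone_mx_rep _ (kolmo_rep kolmo)) applymxE; congr mxapp.
      by apply/funext => k; rewrite mxE.
    by apply/funext => k; apply/funext => l; rewrite /opm mxE.
  by rewrite E; congr mxapp; apply/funext => j; rewrite mxE.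
rewrite (le_trans (fdot_le _ _))// expr2 mulrA ler_wpM2r ?l2norm_ge0//.
Qed.

End KolmogorovFactor.

(** * Norms and cb-norms of operator matrices *)

Section FactorNorms.
Variable R : realType.
Local Notation C := (R[i]).
Local Open Scope complex_scope.

Lemma opmx_norm_le (X Y : normedModType C) n m (T : 'M[bop X Y]_(n, m)) d :
  0 <= d -> mxbounded (opm T) d -> (opmx_norm T <= d%:E)%E.
Proof. by move=> d0 h; apply/mxopnorm_leP => // *; rewrite bopZ. Qed.

Lemma opmx_norm_bounded (X Y : normedModType C) n m (T : 'M[bop X Y]_(n, m)) M :
  (opmx_norm T <= M%:E)%E -> mxbounded (opm T) `|M|.
Proof. by apply: mxopnorm_bounded => *; rewrite /opm bopZ. Qed.

(** An element of the amplified column space is an operator from scalar vectors, and the amplified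
    [T] acts on it by composition on the left, block by block. Hence the cb-norm needs no more than
    the bound on [T]. *)
Lemma factor_cbnorm_le (X Y : hilbertType C) n (T : 'M[bop X Y]_n) d :
  0 <= d -> mxbounded (opm T) d -> (factor_cbnorm T <= d%:E)%E.
Proof.
move=> d0 hT; apply: ge_ereal_sup => _ [N _ <-]; apply: opnorm_le => B B1.
have hB := (mxopnorm_leP ler01 _).1 B1.
have {}hB := hB (fun i j a c => esym (scalerA _ _ _)).
apply/mxopnorm_leP => // [i j a c|c]; first by rewrite scalerA.
pose u (ik : 'I_N * 'I_n) : X := \sum_j c j *: B ik.1 j ik.2 0.
apply: (@le_trans _ _ (d * l2norm u)); last first.
  by rewrite ler_wpM2l// (le_trans (hB c))// mul1r.
rewrite (_ : mxapp _ c = fun ik : 'I_N * 'I_n =>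
  mxapp (opm T) (fun l => u (ik.1, l)) ik.2).
  exact: (@l2norm_amplify R X Y 'I_N 'I_n 'I_n (mxapp (opm T)) d u d0 hT).
apply/funext => -[i k] /=; rewrite -mxapp_comb; apply: eq_bigr => j _.
by rewrite mxE applymxE.
Qed.

End FactorNorms.

(** * Reproducing kernel spaces *)

Section ReproducingKernel.
Variable R : realType.
Local Notation C := (R[i]).
Local Open Scope complex_scope.
Variables (V : completeNormedModType C) (Omega : forall n, set 'M[V]_n).
Variables (A : cstarType C) (Y HK : hilbertType C).
Variables (K : kernel V A Y) (sigma : A -> bop HK HK).
Variable ev : HK -> forall n, 'M[V]_n -> 'M[bop A Y]_n.
Hypothesis cpK : is_cp_nckernel Omega K.
Hypothesis rk : is_rkhs Omega K sigma ev.

Let space := rkhs_space rk.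
Let rep : star_rep sigma := action_rep space.

Definition unit_vec n (j l : 'I_n) : A := if l == j then cone else 0.

(* The kernel element [K_{W,v,y}] for [v] the j-th unit row; a junk value when [W]
   is outside [Omega]. *)
Definition kvec m (W : 'M[V]_m) (y : 'I_m -> Y) (j : 'I_m) : HK :=
  xget 0 [set k | forall f, fdot (fun i => ev f W i j cone) y = rdot f k].

Lemma mxapp_unit_vec (f : HK) n (W : 'M[V]_n) j a :
  mxapp (opm (ev f W)) (fun l => cmul (unit_vec j l) a) =
  fun i => ev f W i j a.
Proof.
apply/funext => i; rewrite /mxapp (bigD1 j)//= /unit_vec eqxx cmul1x.
by rewrite big1 ?addr0// => l /negbTE->; rewrite /opm cmul0l bop0.
Qed.

Lemma mxapp_unit_vec1 (f : HK) n (W : 'M[V]_n) j :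
  mxapp (opm (ev f W)) (unit_vec j) = fun i => ev f W i j cone.
Proof.
rewrite -mxapp_unit_vec; congr mxapp; apply/funext => l.
by rewrite cmulx1.
Qed.

Lemma kvecP n (W : 'M[V]_n) y j f : Omega W ->
  fdot (fun i => ev f W i j cone) y = rdot f (kvec W y j).
Proof.
move=> OW; move: f.
suff : (exists k : HK, forall f, fdot (fun i => ev f W i j cone) y = rdot f k).
  by move/(@xgetPex _ 0 [set k | forall f,
    fdot (fun i => ev f W i j cone) y = rdot f k]).
(* The entries of a unit row are self-adjoint, so [v^*] in the reproducing identity is the unit
   column. *)
have [k [_ hk]] := rkhs_kernel rk (\row_l unit_vec j l) (\col_i y i) OW.
exists k => f; rewrite -mxapp_unit_vec1 /= [RHS]/rdot -hk Re_cdot.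
apply: eq_bigr => i _; rewrite applymxE mxE.
congr (rdot (mxapp _ _ _) _); apply/funext => l; rewrite !mxE /unit_vec.
by case: ifP => _; rewrite ?star1 ?star0.
Qed.

Lemma ev_action (f : HK) a n (W : 'M[V]_n) j : Omega W ->
  (fun i => ev (sigma a f) W i j cone) = (fun i => ev f W i j a).
Proof.
move=> OW; rewrite -mxapp_unit_vec1 -mxapp_unit_vec; apply/funext => i.
have := congr1 (fun w : 'cV_n => w i 0) (actionE space a f (\col_l unit_vec j l) OW).
rewrite !applymxE => E; transitivity (mxapp (opm (ev (sigma a f) W))
  (fun l => (\col_l unit_vec j l) l 0) i).
  by congr mxapp; apply/funext => l; rewrite mxE.
by rewrite E; congr mxapp; apply/funext => l; rewrite !mxE.
Qed.

(** [f(W)(u)] is the sum over [j] of [f(W)(e_j u_j) = (sigma(u_j) f)(W)(e_j)]. Pairing with [y]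
    gives [<sigma(u_j) f, K_{W,e_j,y}>], and [sigma(u_j)] moves to the other side. *)
Lemma reproducing n (W : 'M[V]_n) (u : 'I_n -> A) y f : Omega W ->
  fdot (mxapp (opm (ev f W)) u) y =
  rdot f (\sum_j sigma (star (u j)) (kvec W y j)).
Proof.
move=> OW; rewrite rdot_sumr /fdot /mxapp.
under eq_bigr do rewrite rdot_suml.
rewrite exchange_big; apply: eq_bigr => j _; rewrite rdotC (rep_star rep) rdotC.
by rewrite -kvecP// ev_action.
Qed.

(** Both sides equal [<K_{W,v,y}, K_{Z,e_i,z}>]: reproducing with the second vector gives the left
    side, with the first the right side. *)
Lemma kernel_row n m (Z : 'M[V]_n) (W : 'M[V]_m) (i : 'I_n) (v : 'rV[A]_m)
    (y : 'I_m -> Y) (z : 'I_n -> Y) : Omega Z -> Omega W ->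
  fdot (mxapp (opm (K Z W (\col_l unit_vec i l *cm v))) y) z =
  rdot (\sum_j sigma (v 0 j) (kvec W y j)) (kvec Z z i).
Proof.
move=> OZ OW; have [k [hk1 hk2]] := rkhs_kernel rk v (\col_j y j) OW.
transitivity (fdot (mxapp (opm (ev k Z)) (unit_vec i)) z).
  apply: eq_bigr => l _; congr rdot.
  have := congr1 (fun w : 'cV_n => w l 0) (hk1 n Z (\col_l unit_vec i l) OZ).
  rewrite !applymxE => E; transitivity (mxapp (opm
    (K Z W (\col_l unit_vec i l *cm v))) (fun j => (\col_j y j) j 0) l).
    by congr mxapp; apply/funext => j; rewrite mxE.
  by rewrite -E; congr mxapp; apply/funext => j; rewrite mxE.
rewrite mxapp_unit_vec1 kvecP// rdotC.
rewrite {1}/rdot -hk2 Re_cdot rdotC.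
transitivity (fdot (mxapp (opm (ev (kvec Z z i) W)) (fun j => star (v 0 j))) y).
  apply: eq_bigr => l _; rewrite applymxE mxE; congr (rdot (mxapp _ _ _) _).
  by apply/funext => j; rewrite !mxE.
rewrite reproducing//; congr rdot.
by apply: eq_bigr => j _; rewrite starK.
Qed.

(** [kvec] thus serves as the adjoint factor [h]. By additivity of [K(Z,W)] the identity reduces to
    matrices [e_i v] with a single nonzero row, which [kernel_row] covers. *)
Lemma rkhs_factor n m (Z : 'M[V]_n) (W : 'M[V]_m) (P : 'M[A]_(n, m))
    (y : 'I_m -> Y) (z : 'I_n -> Y) : Omega Z -> Omega W ->
  fdot (mxapp (opm (K Z W P)) y) z =
  fdot (mxapp (repmx sigma P) (kvec W y)) (kvec Z z).
Proof.
move=> OZ OW.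
have PE : P = \sum_i \col_l unit_vec i l *cm row i P.
  apply/matrixP => k l; rewrite summxE (bigD1 k)//= big1 ?addr0 => [|i /negbTE ik].
    by rewrite mxE big_ord1 !mxE /unit_vec eqxx cmul1x.
  by rewrite mxE big_ord1 !mxE /unit_vec eq_sym ik cmul0l.
pose phi Q := fdot (mxapp (opm (K Z W Q)) y) z.
have phiD : {morph phi : Q Q' / Q + Q'}.
  move=> Q Q'; have := nckernel_linear cpK OZ OW 1 Q Q'.
  have mx1 (U : lmodType C) (T : 'M[U]_(n, m)) : map_mx (fun a => 1 *: a) T = T.
    by apply/matrixP => k l; rewrite mxE scale1r.
  rewrite !mx1 /phi => ->; rewrite /fdot -big_split; apply: eq_bigr => i _ /=.
  rewrite -rdotDl /mxapp -big_split; congr rdot; apply: eq_bigr => j _ /=.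
  by rewrite /opm mxE.
have phi0 : phi 0 = 0 by apply: (addrI (phi 0)); rewrite -phiD !addr0.
rewrite -/(phi P) {1}PE (big_morph phi phiD phi0); apply: eq_bigr => i _.
rewrite /phi kernel_row//; congr rdot; apply: eq_bigr => j _.
by rewrite mxE.
Qed.

(** * Norms of evaluations and uniform bounds on kernel vectors *)

Section Norms.
Variables (E : hilbertType C) (iota : A -> bop E E).
Hypothesis iota_rep : star_rep iota.
Hypothesis iota_isom : forall a : A,
  opmx_norm (\matrix_(i < 1, j < 1) iota a) = (rnorm a)%:E.

Lemma ev_column_bound (I : finType) n (W : 'M[V]_n) f (u : I * 'I_n -> A)
    (c d : R) : Omega W -> 0 <= c -> 0 <= d ->
    (forall y, l2norm (kvec W y) <= d * l2norm y) ->
    mxbounded (repmx iota (fun ik (_ : 'I_1) => u ik)) c ->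
  l2norm (fun ik : I * 'I_n =>
    mxapp (opm (ev f W)) (fun k => u (ik.1, k)) ik.2) <= rnorm f * (c * d).
Proof.
move=> OW c0 d0 hk hu; set y := (X in l2norm X).
have : 0 <= l2norm y by exact: l2norm_ge0.
rewrite le_eqVlt => /orP[/eqP<-|y0]; first by rewrite !mulr_ge0 ?rnorm_ge0.
rewrite -(ler_pM2r y0) -expr2 -fdotxx.
pose ky (ik : I * 'I_n) := kvec W (fun k => y (ik.1, k)) ik.2.
have lky : l2norm ky <= d * l2norm y by exact: l2norm_amplify.
pose P (_ : 'I_1) (ik : I * 'I_n) : A := star (u ik).
have hP : mxbounded (repmx sigma P) c.
  apply: (rep_complete_contract iota_rep iota_isom rep c0).
  exact: (repmx_bounded_star iota_rep c0 hu).
rewrite (_ : fdot y y = rdot f (mxapp (repmx sigma P) ky ord0)).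
  apply: (le_trans (rdot_le _ _)); rewrite -[leRHS]mulrA ler_wpM2l ?rnorm_ge0//.
  apply: (le_trans (rnorm_le_l2norm _ _)); apply: (le_trans (hP _)).
  by rewrite -mulrA ler_wpM2l.
transitivity (\sum_i fdot (mxapp (opm (ev f W)) (fun k => u (i, k)))
                          (fun k => y (i, k))).
  by rewrite /fdot pair_bigA; apply: eq_bigr => -[].
under eq_bigr do rewrite reproducing//.
rewrite -rdot_sumr; congr rdot; rewrite /mxapp pair_bigA.
by apply: eq_bigr => -[].
Qed.

Lemma fun_norm_le f n (W : 'M[V]_n) d : Omega W -> 0 <= d ->
    (forall y, l2norm (kvec W y) <= d * l2norm y) ->
  (fun_norm iota (ev f W) <= (rnorm f * d)%:E)%E.
Proof.
move=> OW d0 hk; apply: opnorm_le => u u1.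
have hu := (mxopnorm_leP ler01 _).1 u1.
have {}hu := hu (fun i j a x => bopZ _ _ _).
pose v (ik : 'I_1 * 'I_n) : A := u ik.2 0.
have bij : bijective (snd : 'I_1 * 'I_n -> 'I_n).
  by exists (pair ord0) => // -[i j] /=; rewrite (ord1 i).
have hv : mxbounded (repmx iota (fun ik (_ : 'I_1) => v ik)) 1.
  apply: (@mxbounded_reindex _ _ _ _ _ _ _ _ (pair ord0) id).
  - by exists snd => // -[i j] /=; rewrite (ord1 i).
  - by exists id.
  move=> x; apply: le_trans (hu x); rewrite le_eqVlt; apply/orP; left.
  apply/eqP; congr l2norm; apply/funext => i; apply: eq_bigr => j _.
  by rewrite /repmx /v /= mxE (ord1 j).
have := ev_column_bound f OW ler01 d0 hk hv; rewrite mul1r lee_fin.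
apply: le_trans; rewrite le_eqVlt; apply/orP; left; apply/eqP.
rewrite -(l2norm_reindex _ bij); congr l2norm; apply/funext => -[i k] /=.
by rewrite applymxE.
Qed.

(** Applying a contractive [B] to a scalar vector [c] leaves one column [u] over [A] of norm at most
    [|c|], to which [ev_column_bound] applies. *)
Lemma fun_cbnorm_le f n (W : 'M[V]_n) d : Omega W -> 0 <= d ->
    (forall y, l2norm (kvec W y) <= d * l2norm y) ->
  (fun_cbnorm iota (ev f W) <= (rnorm f * d)%:E)%E.
Proof.
move=> OW d0 hk; apply: ge_ereal_sup => _ [N _ <-]; apply: opnorm_le => B B1.
have hB := (mxopnorm_leP ler01 _).1 B1.
have {}hB := hB (fun i j a x => bopZ _ _ _).
apply/mxopnorm_leP => [|i j a c|c]; [by rewrite mulr_ge0 ?rnorm_ge0| |].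
  by rewrite scalerA.
pose u (ik : 'I_N * 'I_n) : A := \sum_j c j *: B ik.1 j ik.2 0.
have hu : mxbounded (repmx iota (fun ik (_ : 'I_1) => u ik)) (l2norm c).
  (* The tensor [c] with [x] has norm [|c| |x|], and [B] applied to it is [u] applied to [x]. *)
  move=> x; pose x' (jl : 'I_N * 'I_1) : E := c jl.1 *: x jl.2.
  have -> : mxapp (repmx iota (fun ik (_ : 'I_1) => u ik)) x =
    mxapp (fun (i : 'I_N * 'I_n) (j : 'I_N * 'I_1) =>
      map_mx (map_mx iota) B i.1 j.1 i.2 j.2 : E -> E) x'.
    apply/funext => ik; rewrite /mxapp big_ord1 /repmx (rep_sum iota_rep).
    rewrite [RHS](eq_bigr (fun jl => iota (B ik.1 jl.1 ik.2 jl.2)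
      (c jl.1 *: x jl.2))); last by move=> jl _; rewrite !mxE.
    rewrite -(pair_bigA _ (fun j l => iota (B ik.1 j ik.2 l) (c j *: x l)))/=.
    by apply: eq_bigr => j _; rewrite big_ord1 bopZ (repZ iota_rep).
  apply: (le_trans (hB x')); rewrite mul1r.
  rewrite -(ler_pXn2r (ltn0Sn 1)) ?nnegrE ?mulr_ge0 ?l2norm_ge0//.
  rewrite exprMn l2norm_pair (sqr_l2norm c) mulr_suml; apply: ler_sum => j _.
  by rewrite /x' /= l2normZ exprMn.
have := ev_column_bound f OW (l2norm_ge0 c) d0 hk hu.
rewrite mulrCA mulrC; apply: le_trans; rewrite le_eqVlt; apply/orP; left.
apply/eqP; congr l2norm; apply/funext => -[i k] /=; rewrite -mxapp_comb.
by apply: eq_bigr => j _; rewrite mxE applymxE.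
Qed.

Lemma ev_unit_bound f n (W : 'M[V]_n) M j :
    (fun_norm iota (ev f W) <= M%:E)%E ->
  l2norm (fun i => ev f W i j cone) <= M.
Proof.
move=> hM; rewrite -lee_fin; apply: le_trans hM; apply: ereal_sup_ubound.
exists (\col_l unit_vec j l) => /=; last first.
  rewrite -mxapp_unit_vec1; congr (l2norm _)%:E; apply/funext => i.
  rewrite applymxE.
  by congr mxapp; apply/funext => l; rewrite mxE.
apply/mxopnorm_leP; [exact: ler01|by move=> *; rewrite bopZ|move=> x].
rewrite mul1r /l2norm (bigD1 j)//= big1 ?addr0 => [|l /negbTE lj].
  by rewrite /mxapp !big_ord1 !mxE /unit_vec eqxx (rep1 iota_rep).
by rewrite /mxapp big_ord1 !mxE /unit_vec lj (rep0 iota_rep) rnorm0 expr0n.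
Qed.

(** Uniform boundedness for the vectors [K_{W,e_j,y} / |y|]: their pairing with [f] is that of
    [f(W)(e_j)] with [y / |y|], bounded by hypothesis for each [f]. *)
Lemma kernel_uniform_bound n (S : set 'M[V]_n) :
    (forall W, S W -> Omega W) ->
    (forall f, exists M : R, forall W, S W -> (fun_norm iota (ev f W) <= M%:E)%E) ->
  exists2 d : R, 0 <= d &
    forall W, S W -> forall y, l2norm (kvec W y) <= d * l2norm y.
Proof.
move=> SO hS.
have [|M hM] := @weakly_bounded_bounded R HK [set s | exists W y j,
    S W /\ s = (l2norm y)^-1%:C *: kvec W y j].
  move=> f; have [M hM] := hS f; exists `|M| => _ [W [y [j [SW ->]]]].
  rewrite rdotZr -kvecP; last exact: SO.
  have := l2norm_ge0 y; rewrite le_eqVlt => /orP[/eqP<-|y0].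
    by rewrite invr0 mul0r.
  rewrite ler_pdivrMl// mulrC (le_trans (fdot_le _ _))// ler_wpM2r//.
    exact: ltW.
  exact: le_trans (ev_unit_bound j (hM W SW)) (ler_norm M).
(* The norm of [kvec W y] is at most the sum over its [n] entries, each bounded by [|M| |y|]. *)
exists (n%:R * `|M|) => [|W SW y]; first by rewrite mulr_ge0.
have OW := SO W SW.
(* Normalizing says nothing when [|y| = 0]; there [|kvec W y|^2 = <K(W,W)(1) y, y>] vanishes. *)
have := l2norm_ge0 y; rewrite le_eqVlt => /orP[/eqP/esym y0|y0].
  rewrite y0 mulr0 -sqrtr0 ler_sqrt// -sqr_l2norm -fdotxx.
  rewrite -{1}(cone_mx_rep (kvec W y) rep) -rkhs_factor//.
  by rewrite (le_trans (fdot_le _ _))// y0 mulr0.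
apply: (le_trans (l2norm_le_sum _)); rewrite -mulrA mulr_natl.
rewrite [leRHS](_ : _ = \sum_(j < n) `|M| * l2norm y); last first.
  by rewrite sumr_const card_ord.
apply: ler_sum => j _.
rewrite -ler_pdivrMr// mulrC.
have : rnorm ((l2norm y)^-1%:C *: kvec W y j) <= M.
  by apply: hM; exists W, y, j.
rewrite rnormZR ger0_norm ?invr_ge0 ?(ltW y0)// => /le_trans; apply.
exact: ler_norm.
Qed.

End Norms.
End ReproducingKernel.

(** * Transfer of bounds on a ball between the kernel, its factor and the functions *)

Theorem theorem3p16 (R : realType) (V : completeNormedModType R[i])
    (nrm : forall n, 'M[V]_n -> R) (Omega : forall n, set 'M[V]_n)
    (A : cstarType R[i]) (E : hilbertType R[i]) (iota : A -> bop E E)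
    (Y : hilbertType R[i])
    (nrm_adm : admissible nrm)
    (Omega_nc : is_ncset Omega)
    (Omega_open : nc_open nrm Omega)
    (iota_rep : star_rep iota)
    (iota_isom : forall a : A, opmx_norm (\matrix_(i < 1, j < 1) iota a) =
                               (rnorm a)%:E) :
  (forall (K : kernel V A Y) (HK : hilbertType R[i]) (sigma : A -> bop HK HK)
      (ev : HK -> forall n, 'M[V]_n -> 'M[bop A Y]_n)
      (X : hilbertType R[i]) (sigmaX : A -> bop X X)
      (H : forall n, 'M[V]_n -> 'M[bop X Y]_n),
    is_cp_nckernel Omega K ->
    P_locally_bounded nrm Omega K ->
    is_rkhs Omega K sigma ev ->
    is_min_kolmogorov Omega K sigmaX H ->
    [/\ forall f : HK,
          locally_bounded nrm Omega
            (fun n Z => fun_norm iota (ev f n Z)) /\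
          locally_bounded nrm Omega
            (fun n Z => fun_cbnorm iota (ev f n Z)),
        locally_bounded nrm Omega (fun n Z => opmx_norm (H n Z)) /\
        locally_bounded nrm Omega (fun n Z => factor_cbnorm (H n Z))
      & forall n (Z : 'M[V]_n) (eps : R), Omega n Z -> 0 < eps ->
          bounded_on_ball nrm Omega Z eps
            (fun Z' => opmx_norm (K n n Z' Z' (cone_mx A n))) ->
          (forall f : HK,
             bounded_on_ball nrm Omega Z eps
               (fun Z' => fun_norm iota (ev f n Z')) /\
             bounded_on_ball nrm Omega Z eps
               (fun Z' => fun_cbnorm iota (ev f n Z'))) /\
          bounded_on_ball nrm Omega Z eps (fun Z' => opmx_norm (H n Z')) /\
          bounded_on_ball nrm Omega Z eps (fun Z' => factor_cbnorm (H n Z'))])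
  /\
  (forall (HH : hilbertType R[i]) (sigma : A -> bop HH HH)
      (ev : HH -> forall n, 'M[V]_n -> 'M[bop A Y]_n) (K : kernel V A Y),
    is_ncfun_hilbert Omega iota sigma ev ->
    is_cp_nckernel Omega K ->
    is_rkhs Omega K sigma ev ->
    (forall n (Z : 'M[V]_n), Omega n Z ->
       exists2 eps : R, 0 < eps &
         forall f : HH, bounded_on_ball nrm Omega Z eps
           (fun Z' => fun_norm iota (ev f n Z'))) ->
    [/\ P_locally_bounded nrm Omega K,
        P_locally_cb nrm Omega iota K
      & forall n (Z : 'M[V]_n) (eps : R), Omega n Z -> 0 < eps ->
          (forall f : HH, bounded_on_ball nrm Omega Z eps
             (fun Z' => fun_norm iota (ev f n Z'))) ->
          bounded_on_ball nrm Omega Z eps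
            (fun Z' => opmx_norm (K n n Z' Z' (cone_mx A n))) /\
          forall D, nrm n D < eps ->
            opmx_norm (K n n (Z + D) (Z + D) (cone_mx A n)) =
            kernel_cbnorm iota (K n n (Z + D) (Z + D))]).
Proof.
split=> [K HK sigma ev X sigmaX H cpK PB rk kolmo|HH sigma ev K _ cpK rk fb].
  have rep : star_rep sigma := action_rep (rkhs_space rk).
  have fact := rkhs_factor cpK rk.
  have bound := factor_bound rep fact.
  have core n (Z : 'M[V]_n) (eps : R) :
      bounded_on_ball nrm Omega Z eps
        (fun Z' => opmx_norm (K n n Z' Z' (cone_mx A n))) ->
      (forall f : HK,
         bounded_on_ball nrm Omega Z eps (fun Z' => fun_norm iota (ev f n Z')) /\
         bounded_on_ball nrm Omega Z eps
           (fun Z' => fun_cbnorm iota (ev f n Z'))) /\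
      bounded_on_ball nrm Omega Z eps (fun Z' => opmx_norm (H n Z')) /\
      bounded_on_ball nrm Omega Z eps (fun Z' => factor_cbnorm (H n Z')).
    (* [M] carries no sign, so [|M|] replaces it; its root bounds the kernel vectors and [H] on the
       same ball. *)
    move=> [M hM]; set s := Num.sqrt `|M|; have s0 : 0 <= s := sqrtr_ge0 _.
    have hK D : nrm n D < eps -> Omega n (Z + D) /\
        mxbounded (opm (K n n (Z + D) (Z + D) (cone_mx A n))) `|M|.
      by move=> /hM[OD /opmx_norm_bounded hD].
    split=> [f|]; split.
    - exists (rnorm f * s) => D /hK[OD hD]; split=> //.
      by apply: (fun_norm_le rk iota_rep iota_isom) => // y; exact: bound.
    - exists (rnorm f * s) => D /hK[OD hD]; split=> //.
      by apply: (fun_cbnorm_le rk iota_rep iota_isom) => // y; exact: bound.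
    - exists s => D /hK[OD hD]; split=> //.
      by apply: opmx_norm_le => //; exact: (kolmo_mxbounded kolmo).
    - exists s => D /hK[OD hD]; split=> //.
      by apply: factor_cbnorm_le => //; exact: (kolmo_mxbounded kolmo).
  have loc n (Z : 'M[V]_n) : Omega n Z -> exists2 eps : R, 0 < eps &
      bounded_on_ball nrm Omega Z eps
        (fun Z' => opmx_norm (K n n Z' Z' (cone_mx A n))).
    (* The diagonal case of local boundedness, at [P = 1] and with equal displacements. *)
    move=> OZ; have [eps e0 [M hM]] := PB n n Z Z (cone_mx A n) OZ OZ.
    by exists eps => //; exists M => D De; have [] := hM D D De De.
  split.
  - move=> f; split=> n Z OZ; have [eps e0 /core[/(_ f)[b1 b2] _]] := loc n Z OZ;
    by exists eps.
  - split=> n Z OZ; have [eps e0 /core[_ [b1 b2]]] := loc n Z OZ; by exists eps.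
  - by move=> n Z eps _ _; exact: core.
have rep : star_rep sigma := action_rep (rkhs_space rk).
have fact := rkhs_factor cpK rk.
have core n (Z : 'M[V]_n) (eps : R) :
    (forall f : HH,
       bounded_on_ball nrm Omega Z eps (fun Z' => fun_norm iota (ev f n Z'))) ->
    (forall D, nrm n D < eps -> Omega n (Z + D)) /\
    exists2 d : R, 0 <= d & forall D, nrm n D < eps ->
      forall y, l2norm (kvec ev (Z + D) y) <= d * l2norm y.
  (* The hypothesis at one element, here 0, already places the ball in [Omega]. *)
  move=> hf; have OD D : nrm n D < eps -> Omega n (Z + D).
    by have [M hM] := hf 0; move=> /hM[].
  (* As [eps] is common to all [f], the whole ball is one index set for the uniform boundedness
     principle. *)
  split=> //; have [||d d0 hd] := @kernel_uniform_bound _ _ _ _ _ _ _ _ _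
    cpK rk _ _ iota_rep n [set Z' | exists2 D, nrm n D < eps & Z' = Z + D].
  - by move=> _ [D /OD OZ ->].
  - by move=> f; have [M hM] := hf f; exists M => _ [D /hM[_ h] ->].
  - by exists d => // D De; apply: hd; exists D.
split=> [n m Z W P OZ OW|n m Z W OZ OW|n Z eps OZ e0 hf].
- have [e1 e10 /core[O1 [d1 d10 h1]]] := fb n Z OZ.
  have [e2 e20 /core[O2 [d2 d20 h2]]] := fb m W OW.
  exists (Num.min e1 e2); first by rewrite lt_min e10.
  set c := \sum_i \sum_j rnorm (P i j).
  have c0 : 0 <= c.
    by rewrite sumr_ge0// => i _; rewrite sumr_ge0// => j _; exact: rnorm_ge0.
  exists (c * d2 * d1) => DZ DW; rewrite !lt_min => /andP[Z1 _] /andP[_ W2].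
  split; [exact: O1|exact: O2|]; apply: opmx_norm_le; first by rewrite !mulr_ge0.
  apply: (kernel_bound fact (O1 _ Z1) (O2 _ W2) c0 d10 d20 (h1 _ Z1) (h2 _ W2)).
  exact: repmx_crude.
- have [e1 e10 /core[O1 [d1 d10 h1]]] := fb n Z OZ.
  have [e2 e20 /core[O2 [d2 d20 h2]]] := fb m W OW.
  exists (Num.min e1 e2); first by rewrite lt_min e10.
  exists (d2 * d1) => DZ DW; rewrite !lt_min => /andP[Z1 _] /andP[_ W2].
  split; [exact: O1|exact: O2|].
  exact: (kernel_cb_bound iota_rep iota_isom rep fact (O1 _ Z1) (O2 _ W2)
            d10 d20 (h1 _ Z1) (h2 _ W2)).
have [OD [d d0 hd]] := core n Z eps hf.
(* The unit acts as the identity, so only the two outer factors contribute. The bound also provides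
   the finiteness required by [opmx_norm_kernel1]. *)
have hK D : nrm n D < eps ->
    (opmx_norm (K n n (Z + D)%R (Z + D)%R (cone_mx A n)) <= (d * d)%:E)%E.
  move=> De; apply: opmx_norm_le; first exact: mulr_ge0.
  rewrite -[d * d]mul1r mulrA; have ODe := OD D De.
  apply: (kernel_bound fact ODe ODe ler01 d0 d0 (hd D De) (hd D De)) => x.
  by rewrite (cone_mx_rep _ rep) mul1r.
split; first by exists (d * d) => D De; split; [exact: OD|exact: hK].
move=> D De.
exact: (opmx_norm_kernel1 iota_rep iota_isom rep fact (OD D De) (hK D De)).
Qed.
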